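(* Let $\mathfrak{s}$ be a $7$-dimensional real vector space with fixed basis $\{e_1,\dots,e_7\}$ and fixed positive $3$-form $\varphi=e^{127}+e^{347}+e^{567}+e^{135}-e^{146}-e^{236}-e^{245}$. Let $\mathcal{S}_{closed}$, $\mathcal{S}_{\mathbb{R}}$, $\mathcal{S}_{tf}$, the functional $F$ and the numbers $n_\mu$ be as defined in the context; that is, $\mathcal{S}_{closed}$ is the set of solvable Lie brackets $\mu$ on $\mathfrak{s}$ with $d_\mu\varphi=0$, $\mathcal{S}_{\mathbb{R}}$ is the set of solvable Lie brackets of real type, and $n_\mu$ is the infimum of $F=\mathrm{Scal}^2/|\mathrm{Ric}|^2$ over $(\mathrm{GL}_7(\mathbb{R})\cdot\mu\cap\mathcal{S}_{closed})\smallsetminus\mathcal{S}_{tf}$. Then: (i) $0<n_\mu$ for any $\mu\in\mathcal{S}_{closed}\cap\mathcal{S}_{\mathbb{R}}$. (ii) $\inf\{n_\mu:\mu\in\mathcal{S}_{closed}\cap\mathcal{S}_{\mathbb{R}}\}=0$.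
   Context: Here $\{e^i\}$ is the dual basis and $e^{ijk}=e^i\wedge e^j\wedge e^k$. Let $\langle\cdot,\cdot\rangle$ be the inner product on $\mathfrak{s}$ making $\{e_1,\dots,e_7\}$ orthonormal; it is the inner product associated to the $G_2$-structure $\varphi$. Let $\ast$ be the corresponding Hodge star operator on $\Lambda^\bullet\mathfrak{s}^*$, with orientation $e^1\wedge\dots\wedge e^7$. $\mathcal{S}\subset\Lambda^2\mathfrak{s}^*\otimes\mathfrak{s}$ is the set of all Lie brackets $\mu$ on $\mathfrak{s}$ such that $(\mathfrak{s},\mu)$ is a solvable Lie algebra. For $\mu\in\mathcal{S}$, $S_\mu$ is the simply connected Lie group with Lie algebra $(\mathfrak{s},\mu)$, endowed with the left-invariant $G_2$-structure determined by $\varphi$ and the left-invariant Riemannian metric determined by $\langle\cdot,\cdot\rangle$. Let $\mathrm{Scal}_\mu\in\mathbb{R}$ and $\mathrm{Ric}_\mu\in\mathrm{End}(\mathfrak{s})$ denote the scalar curvature and the Ricci operator of $(S_\mu,\langle\cdot,\cdot\rangle)$, with $|\mathrm{Ric}_\mu|^2=\mathrm{tr}(\mathrm{Ric}_\mu^2)$. Let $d_\mu$ denote the exterior differential of left-invariant forms on $S_\mu$ (the Chevalley–Eilenberg differential of $(\mathfrak{s},\mu)$). The group $\mathrm{GL}_7(\mathbb{R})=\mathrm{GL}(\mathfrak{s})$ acts on brackets by $h\cdot\mu=h\mu(h^{-1}\cdot,h^{-1}\cdot)$. Define: - $\mathcal{S}_{closed}=\{\mu\in\mathcal{S}: d_\mu\varphi=0\}$;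 - $\mathcal{S}_{tf}=\{\mu\in\mathcal{S}: d_\mu\varphi=0,\ d_\mu\ast\varphi=0\}$ (for $\mu\in\mathcal{S}_{closed}$ one has $\mu\in\mathcal{S}_{tf}$ if and only if $\mathrm{Scal}_\mu=0$, if and only if $(S_\mu,\langle\cdot,\cdot\rangle)$ is flat); - $\mathcal{S}_{\mathbb{R}}=\{\mu\in\mathcal{S}:$ for every $X\in\mathfrak{s}$, either $\mathrm{ad}_\mu X$ is nilpotent or $\mathrm{Spec}(\mathrm{ad}_\mu X)\nsubseteq \mathrm{i}\mathbb{R}\}$, where $\mathrm{Spec}(\mathrm{ad}_\mu X)\subset\mathbb{C}$ is the set of eigenvalues of $\mathrm{ad}_\mu X$ (Lie algebras of real type). The functional is $$F:\mathcal{S}_{closed}\smallsetminus\mathcal{S}_{tf}\to\mathbb{R},\qquad F(\mu)=\frac{\mathrm{Scal}_\mu^2}{|\mathrm{Ric}_\mu|^2}.$$ For a subset $\mathcal{C}\subset\mathcal{S}_{closed}$, $F(\mathcal{C})$ means $F(\mathcal{C}\smallsetminus\mathcal{S}_{tf})$. For $\mu\in\mathcal{S}_{closed}$, define $$n_\mu:=\inf F(\mathrm{GL}_7(\mathbb{R})\cdot\mu\cap\mathcal{S}_{closed}),$$ the infimum of $F$ over all closed, non-torsion-free left-invariant $G_2$-structures on $S_\mu$, with the convention $\inf\emptyset=+\infty$ (relevant for $\mu=0$). *)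

(* Defs.v *)
From HB Require Import structures.
From mathcomp Require Import all_boot all_order all_algebra.
From mathcomp Require Import complex.
From mathcomp Require Import all_classical all_reals ereal.

Set Implicit Arguments.
Unset Strict Implicit.
Unset Printing Implicit Defensive.

Import Order.TTheory GRing.Theory Num.Theory.
Local Open Scope classical_set_scope.
Local Open Scope ring_scope.

(** Vectors of R^n are row vectors, so the endomorphism
    of R^n with matrix A is [v |-> v *m A]. *)

Definition basis_vec (R : realType) (n : nat) (i : 'I_n) : 'rV[R]_n :=
  delta_mx 0 i.

Definition dotv (R : realType) (n : nat) (x y : 'rV[R]_n) : R :=
  \sum_i x 0 i * y 0 i.

(** * Lie brackets on R^n *)

Definition bracket (R : realType) (n : nat) : Type :=
  'rV[R]_n -> 'rV[R]_n -> 'rV[R]_n.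

Record is_lie_bracket (R : realType) (n : nat) (mu : bracket R n) : Prop :=
  IsLieBracket {
    lie_linear_r : forall x, linear (mu x);
    lie_linear_l : forall y, linear (mu^~ y);
    lie_alternating : forall x, mu x x = 0;
    lie_jacobi : forall x y z,
      mu x (mu y z) + mu y (mu z x) + mu z (mu x y) = 0 }.

(** [U, U]; for bilinear [mu], the brackets of the elements of a basis of [U]
    span the brackets of all elements of [U] (cf. [prodv] in falgebra). *)
Definition derived_space (R : realType) (n : nat) (mu : bracket R n)
    (U : {vspace 'rV[R]_n}) : {vspace 'rV[R]_n} :=
  <<[seq mu x y | x <- vbasis U, y <- vbasis U]>>%VS.

Definition lie_solvable (R : realType) (n : nat) (mu : bracket R n) : Prop :=
  exists k : nat, iter k (derived_space mu) fullv = 0%VS.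

Definition ad (R : realType) (n : nat) (mu : bracket R n) (x : 'rV[R]_n)
    : 'M[R]_n :=
  lin1_mx (mu x).

Definition nilpotent_mx (R : realType) (n : nat) (A : 'M[R]_n) : Prop :=
  exists k : nat, A ^+ k = 0.

Definition spec (R : realType) (n : nat) (A : 'M[R]_n) : set R[i] :=
  [set z | eigenvalue (map_mx (real_complex R) A) z].

Definition imaginary_axis (R : realType) : set R[i] :=
  [set z | complex.Re z = 0].

Definition real_type (R : realType) (n : nat) (mu : bracket R n) : Prop :=
  forall x, nilpotent_mx (ad mu x) \/
            ~ (spec (ad mu x) `<=` @imaginary_axis R).

Definition gl_act (R : realType) (n : nat) (h : 'M[R]_n) (mu : bracket R n)
    : bracket R n :=
  fun x y => mu (x *m invmx h) (y *m invmx h) *m h.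

Definition gl_orbit (R : realType) (n : nat) (mu : bracket R n)
    : set (bracket R n) :=
  [set gl_act h mu | h in [set h : 'M[R]_n | h \in unitmx]].

(** * Left-invariant forms
    A k-form is evaluated on the k x n matrix whose rows are its arguments. *)

Definition form (R : realType) (k n : nat) : Type := 'M[R]_(k, n) -> R.

(** e^{I 0} /\ ... /\ e^{I (k-1)}, with
    (a^1 /\ ... /\ a^k)(x_1, ..., x_k) = det (a^j (x_i)). *)
Definition coframe (R : realType) (k n : nat) (I : 'I_k -> 'I_n)
    : form R k n :=
  fun X => \det (colsub I X).

(** Chevalley-Eilenberg differential
    (d w)(x_0, ..., x_k) =
      sum_(i < j) (-1)^(i+j) w([x_i, x_j], x_0, .., ^x_i, .., ^x_j, .., x_k),
    where k = m.+1.  As i < j, x_i is still the i-th row once x_j has been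
    removed. *)
Definition ce_diff (R : realType) (m n : nat) (mu : bracket R n)
    (w : form R m.+1 n) : form R m.+2 n :=
  fun X => \sum_(j < m.+2) \sum_(i < m.+1 | (i < j)%N)
    (-1) ^+ (i + j) *
    w (col_mx (mu (row i (row' j X)) (row j X)) (row' i (row' j X))).

(** Hodge star of R^(k + l) for the dot product and the standard orientation:
    *w = (1/k!) sum_I w(e_I) *(e^I), with
    ( *(e^I))(X) = (e^1 /\ ... /\ e^(k+l))(e_I, X),
    I ranging over all multi-indices of length k. *)
Definition hodge_star (R : realType) (k l : nat) (w : form R k (k + l))
    : form R l (k + l) :=
  fun X => (k`!%:R)^-1 *
    \sum_(I : {ffun 'I_k -> 'I_(k + l)})
      w (rowsub I 1%:M) * \det (col_mx (rowsub I 1%:M) X).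

(** * Curvature of the left-invariant metric *)

(** Levi-Civita connection on left-invariant fields (Koszul formula):
    2 <nabla_x y, z> = <[x, y], z> - <[y, z], x> + <[z, x], y>. *)
Definition nabla (R : realType) (n : nat) (mu : bracket R n)
    (x y : 'rV[R]_n) : 'rV[R]_n :=
  \row_k (2^-1 * (dotv (mu x y) (basis_vec R k)
                  - dotv (mu y (basis_vec R k)) x
                  + dotv (mu (basis_vec R k) x) y)).

Definition curvature (R : realType) (n : nat) (mu : bracket R n)
    (x y z : 'rV[R]_n) : 'rV[R]_n :=
  nabla mu x (nabla mu y z) - nabla mu y (nabla mu x z)
  - nabla mu (mu x y) z.

(** <Ric x, y> = tr (z |-> R(z, x) y) *)
Definition Ric (R : realType) (n : nat) (mu : bracket R n) : 'M[R]_n :=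
  \matrix_(i, j) \sum_k
    dotv (curvature mu (basis_vec R k) (basis_vec R i) (basis_vec R j))
         (basis_vec R k).

Definition Scal (R : realType) (n : nat) (mu : bracket R n) : R :=
  \tr (Ric mu).

Definition Ric_sqnorm (R : realType) (n : nat) (mu : bracket R n) : R :=
  \tr (Ric mu *m Ric mu).

(** * Closed G2-structures on R^7 *)

(** The indices of [e3] run from 1 to 7, those of ['I_7] from 0 to 6. *)
Definition e3 (R : realType) (i j k : nat) : form R 3 7 :=
  coframe (tnth [tuple inord i.-1; inord j.-1; inord k.-1]).

Definition phi (R : realType) : form R 3 7 := fun X =>
  e3 1 2 7 X + e3 3 4 7 X + e3 5 6 7 X + e3 1 3 5 X
  - e3 1 4 6 X - e3 2 3 6 X - e3 2 4 5 X.

Definition star_phi (R : realType) : form R 4 7 :=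
  @hodge_star R 3 4 (@phi R).

Definition S_solv (R : realType) : set (bracket R 7) :=
  [set mu | is_lie_bracket mu /\ lie_solvable mu].

Definition S_closed (R : realType) : set (bracket R 7) :=
  [set mu | S_solv mu /\ forall X, ce_diff mu (@phi R) X = 0].

Definition S_tf (R : realType) : set (bracket R 7) :=
  [set mu | [/\ S_solv mu, forall X, ce_diff mu (@phi R) X = 0
              & forall X, ce_diff mu (@star_phi R) X = 0]].

Definition S_real (R : realType) : set (bracket R 7) :=
  [set mu | S_solv mu /\ real_type mu].

Definition F (R : realType) (mu : bracket R 7) : R :=
  Scal mu ^+ 2 / Ric_sqnorm mu.

(** [ereal_inf set0 = +oo]. *)
Definition n_inf (R : realType) (mu : bracket R 7) : \bar R :=
  ereal_inf [set (F nu)%:E | nu in (gl_orbit mu `&` @S_closed R) `\` @S_tf R].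

(* Main.v *)
(* (i) By Lie's theorem the operators [ad x] are simultaneously triangular over
   C; their diagonal entries, the weights, are real-linear in [x].  Real type
   forces the imaginary parts of the weights to be linear combinations of the
   real parts.  The real parts of the eigenvalues of a matrix are bounded by
   its symmetric part, so [- tr (ad x)^2 <= c |S(ad x)|^2], where [c] is the same
   for all brackets in the GL-orbit.  With the usual formula for the scalar
   curvature of a solvable Lie algebra this gives [|nu|^2 <= c' (- Scal nu)] on
   the orbit, while [|Ric nu|] is always bounded by a multiple of [|nu|^2].

   (ii) Let [e_7] act on [C^3] by a skew-hermitian matrix [K] plus [t] times a
   hermitian matrix [S], both trace-free.  Then [phi] is closed, [Scal] is of
   order [t^2], but [Ric] is of order [t] when [K] and [S] do not commute, so
   [F] tends to [0] with [t]. *)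

Require Import Defs.
From mathcomp Require Import all_boot all_order all_algebra.
From mathcomp Require Import complex ring lra.
From mathcomp Require Import all_classical all_reals ereal.

Set Implicit Arguments.
Unset Strict Implicit.
Unset Printing Implicit Defensive.

Import Order.TTheory GRing.Theory Num.Theory.
Local Open Scope classical_set_scope.
Local Open Scope ring_scope.

(** * Lie's theorem *)

(** In Scal = - |H|^2 - B/2 - |mu|^2/4, where H has coordinates tr (ad e_i) and B = sum_i tr (ad
    e_i)^2, only B has no definite sign. A negative B can cancel |mu|^2: this happens when e_7 acts
    on an abelian ideal by a skew matrix, which gives flat brackets. So (i) amounts to bounding - B
    by a multiple of - Scal. Since tr (ad x)^2 and the eigenvalues are invariant under conjugation,
    the coefficients expressing imaginary parts of weights by real parts belong to the orbit, and
    the symmetric part may be taken after any change of basis. As t tends to 0, the brackets of (ii)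
    approach such a flat bracket, which is not of real type: the ratio of imaginary to real parts of
    weights is of order 1/t, so no constant serves all t. On the ideal Ric is t [K, S] up to sign;
    if K and S commuted, Ric would be of order t^2 like Scal, and F would not tend to 0. *)

(** Matrices act on row vectors from the right, which reverses products; hence the order of the
    commutator. The Lie algebra is real and the representation complex, with [f] embedding the
    scalars. *)
Record lie_rep (R : realType) (C : numClosedFieldType) (f : {rmorphism R -> C})
    (n : nat) (mu : bracket R n) (m : nat) (rho : 'rV[R]_n -> 'M[C]_m) : Prop :=
  LieRep {
    rep_linear : forall a x y, rho (a *: x + y) = f a *: rho x + rho y;
    rep_bracket : forall x y,
      rho (mu x y) = rho y *m rho x - rho x *m rho y }.

(** Apply the linear factors of the characteristic polynomial to [v] one after another. By
    Cayley-Hamilton the result is finally 0; the last nonzero vector is an eigenvector and has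
    stayed in [S]. *)
Lemma eigenvector_in_stable (C : numClosedFieldType) (m : nat) (X : 'M[C]_m)
    (S : 'rV[C]_m -> Prop) (v : 'rV[C]_m) :
  (forall w, S w -> S (w *m X)) ->
  (forall a w w', S w -> S w' -> S (a *: w + w')) ->
  v != 0 -> S v -> exists w, exists a, [/\ w != 0, S w & w *m X = a *: w].
Proof.
case: m X S v => [|m] X S v SX Slin vN0 Sv.
  by rewrite [v]thinmx0 eqxx in vN0.
have [r pE] := closed_field_poly_normal (char_poly X).
have : v *m \prod_(z <- r) (X - z%:M) = 0.
  suff -> : \prod_(z <- r) (X - z%:M) = 0 by rewrite mulmx0.
  rewrite -(Cayley_Hamilton X) pE (eqP (char_poly_monic X)) scale1r rmorph_prod.
  by apply: eq_bigr => z _; rewrite rmorphB /= horner_mx_X horner_mx_C.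
elim: r v vN0 Sv {pE} => [|z r IH] v vN0 Sv.
  by rewrite big_nil mulmx1 => v0; rewrite v0 eqxx in vN0.
rewrite big_cons mulmxA => vr0.
have [w0|wN0] := eqVneq (v *m (X - z%:M)) 0; last first.
  apply: IH vr0 => //; rewrite mulmxBr mul_mx_scalar addrC -scaleNr.
  by apply: Slin => //; apply: SX.
exists v, z; split=> //; apply/eqP.
by rewrite -subr_eq0 -mul_mx_scalar -mulmxBr w0.
Qed.

Lemma rank_col_independent (C : fieldType) (m : nat) (w : nat -> 'rV[C]_m)
    (B := fun k => \matrix_(i < k) w i : 'M[C]_(k, m)) (k : nat) :
  (forall i, (i < k)%N -> ~~ (w i <= B i)%MS) -> row_free (B k).
Proof.
rewrite /row_free eqn_leq rank_leq_row /=.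
elim: k => [|k IH] // wN.
have/IH rk : forall i, (i < k)%N -> ~~ (w i <= B i)%MS.
  by move=> i ik; apply: wN; apply: ltnW.
apply: (leq_ltn_trans rk); apply: rank_ltmx; rewrite /ltmx; apply/andP; split.
  apply/row_subP => i; rewrite rowK.
  have -> : w i = row (widen_ord (leqnSn k) i) (B k.+1) by rewrite rowK.
  exact: row_sub.
apply: contra (wN k (ltnSn k)); apply: submx_trans.
have -> : w k = row ord_max (B k.+1) by rewrite rowK.
exact: row_sub.
Qed.

Lemma krylov_stop (C : fieldType) (m : nat) (w : nat -> 'rV[C]_m)
    (B := fun k => \matrix_(i < k) w i : 'M[C]_(k, m)) :
  exists k, row_free (B k) && (w k <= B k)%MS.
Proof.
have ex : exists k, (w k <= B k)%MS.
  case: (pselect (exists k, (w k <= B k)%MS)) => // nex.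
  have : row_free (B m.+1).
    apply: rank_col_independent => i _; apply/negP => H; apply: nex; by exists i.
  by rewrite /row_free => /eqP e; have := rank_leq_col (B m.+1); rewrite e ltnn.
have [k wk kmin] := ex_minnP ex; exists k; rewrite wk andbT.
apply: rank_col_independent => i ik; apply/negP => /kmin.
by rewrite leqNgt ik.
Qed.

(* The trace of [rho (mu x u)], a commutator, on the Krylov space of [v] under
   [rho x] is [k * lambda (mu x u)], where [k] is the dimension of that space. *)
Lemma weight_bracket (R : realType) (C : numClosedFieldType)
    (f : {rmorphism R -> C}) (n : nat) (mu : bracket R n) (m : nat)
    (rho : 'rV[R]_n -> 'M[C]_m) (x : 'rV[R]_n) (U : 'rV[R]_n -> Prop)
    (v : 'rV[C]_m) (lambda : 'rV[R]_n -> C) :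
  lie_rep f mu rho -> (forall u, U u -> U (mu x u)) -> v != 0 ->
  (forall u, U u -> v *m rho u = lambda u *: v) ->
  forall u, U u -> lambda (mu x u) = 0.
Proof.
move=> rep Ux vN0 vE.
pose X := rho x; pose w i := iter i (mulmxr X) v.
pose B k : 'M[C]_(k, m) := \matrix_(i < k) w i.
have wB i k : (i < k)%N -> (w i <= B k)%MS.
  move=> ik; have -> : w i = row (Ordinal ik) (B k) by rewrite rowK.
  exact: row_sub.
have BX k : (B k *m X <= B k.+1)%MS.
  apply/row_subP => i; rewrite row_mul rowK.
  by rewrite -[_ *m X]/(w i.+1) wB // ltnS.
have BS i k : (i <= k)%N -> (B i <= B k)%MS.
  by move=> ik; apply/row_subP => j; rewrite rowK wB // (leq_trans _ ik).
have comm u : X *m rho u = rho u *m X - rho (mu x u).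
  by rewrite (rep_bracket rep) opprB addrC subrK.
(* Modulo the earlier Krylov vectors, [rho u] acts on each [w i] by the same scalar [lambda u]: it
   is triangular with constant diagonal. *)
have wU i u : U u -> (w i *m rho u - lambda u *: w i <= B i)%MS.
  elim: i u => [|i IH] u Uu; first by rewrite vE // subrr sub0mx.
  rewrite -[w i.+1]/(w i *m X) -mulmxA comm mulmxBr mulmxA.
  have -> : w i *m rho u *m X - w i *m rho (mu x u) - lambda u *: (w i *m X)
    = (w i *m rho u - lambda u *: w i) *m X
     - ((w i *m rho (mu x u) - lambda (mu x u) *: w i) + lambda (mu x u) *: w i).
    by rewrite subrK mulmxBl -scalemxAl addrAC.
  apply: addmx_sub.
    by apply: submx_trans (BX i); apply: submxMr; apply: IH.
  rewrite eqmx_opp; apply: addmx_sub; last by apply: scalemx_sub; apply: wB.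
  by apply: submx_trans (BS i i.+1 (leqnSn i)); apply/IH/Ux.
have [k /andP[Bfree wk]] := krylov_stop w.
have k_gt0 : (0 < k)%N.
  rewrite lt0n; apply: contra vN0 => /eqP k0; move: wk; rewrite k0.
  by case/submxP=> D; rewrite [D]thinmx0 mul0mx => w0; apply/eqP.
have Bstep : (B k.+1 <= B k)%MS.
  apply/row_subP => i; rewrite rowK.
  have := ltn_ord i; rewrite ltnS leq_eqVlt => /predU1P[->|]; first exact: wk.
  exact: wB.
have /submxP[D XE] : (B k *m X <= B k)%MS by apply: submx_trans Bstep.
have Tex u : U u -> exists2 T, B k *m rho u = T *m B k
    & \tr T = k%:R * lambda u.
  move=> Uu.
  have rowE (i : 'I_k) : exists d : 'rV[C]_k,
      w i *m rho u = d *m B k /\ d 0 i = lambda u.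
    have /submxP[d dE] := wU i u Uu.
    (* [W] pads the coordinates with respect to the first [i] Krylov vectors by zeros. *)
    pose W : 'M[C]_(i, k) := \matrix_(a, b) (a == b :> nat)%:R.
    have WB : B i = W *m B k.
      apply/row_matrixP => a; rewrite rowK row_mul.
      have -> : row a W = delta_mx 0 (widen_ord (ltnW (ltn_ord i)) a).
        by apply/rowP => b; rewrite !mxE eqxx /= eq_sym.
      by rewrite -rowE rowK.
    exists (lambda u *: delta_mx 0 i + d *m W); split.
      rewrite mulmxDl -scalemxAl -rowE rowK -mulmxA -WB -dE addrC subrK //.
    rewrite !mxE !eqxx mulr1 big1 ?addr0 // => a _; rewrite mxE.
    by rewrite ltn_eqF ?mulr0 // ltn_ord.
  have [d dE] := choice rowE.
  exists (\matrix_i d i).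
    apply/row_matrixP => i; rewrite !row_mul !rowK.
    by have [-> _] := dE i.
  rewrite /mxtrace (eq_bigr (fun _ => lambda u)).
    by rewrite sumr_const card_ord mulr_natl.
  by move=> i _; rewrite mxE; have [_ ->] := dE i.
move=> u Uu; have [T TE _] := Tex u Uu; have [T' T'E trT'] := Tex _ (Ux u Uu).
have : T' = T *m D - D *m T.
  apply: (row_free_inj Bfree); rewrite -/(B k) -T'E (rep_bracket rep) mulmxBr.
  by rewrite mulmxBl -!mulmxA -XE -TE !mulmxA TE XE -!mulmxA -?TE -?XE -/X.
move/(congr1 mxtrace); rewrite trT' raddfB /= mxtrace_mulC subrr => /eqP.
by rewrite mulf_eq0 pnatr_eq0 -leqn0 leqNgt k_gt0 /= => /eqP.
Qed.

Lemma linear_fun0 (R : nzRingType) (U V : lmodType R) (g : U -> V) :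
  linear g -> g 0 = 0.
Proof. by move=> gl; have := gl (-1) 0 0; rewrite scaler0 addr0 scaleN1r addNr. Qed.

Lemma linear_funZ (R : nzRingType) (U V : lmodType R) (g : U -> V) a u :
  linear g -> g (a *: u) = a *: g u.
Proof. by move=> gl; have := gl a u 0; rewrite (linear_fun0 gl) !addr0. Qed.

Lemma linear_funD (R : nzRingType) (U V : lmodType R) (g : U -> V) u v :
  linear g -> g (u + v) = g u + g v.
Proof. by move=> gl; have := gl 1 u v; rewrite !scale1r. Qed.

Lemma linear_fun_sum (R : nzRingType) (U V : lmodType R) (g : U -> V)
    (I : Type) (r : seq I) (a : I -> R) (u : I -> U) :
  linear g -> g (\sum_(i <- r) a i *: u i) = \sum_(i <- r) a i *: g (u i).
Proof.
move=> gl; elim: r => [|i r IH]; first by rewrite !big_nil linear_fun0.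
by rewrite !big_cons gl IH.
Qed.

Lemma mulmx_lin1 (R : realType) (n p : nat) (g : 'rV[R]_n -> 'rV[R]_p) y :
  linear g -> y *m lin1_mx g = g y.
Proof.
move=> gl; rewrite {2}[y]row_sum_delta (linear_fun_sum _ _ _ gl) mulmx_sum_row.
by apply: eq_bigr => i _; congr (_ *: _); apply/rowP=> j; rewrite !mxE.
Qed.

Section DerivedSeries.
Variables (R : realType) (n : nat) (mu : bracket R n).
Hypothesis mu_lie : is_lie_bracket mu.

Lemma mulmx_ad x y : y *m ad mu x = mu x y.
Proof. exact/mulmx_lin1/(lie_linear_r mu_lie). Qed.

Lemma bracketC x y : mu x y = - mu y x.
Proof.
apply/eqP; rewrite -addr_eq0; apply/eqP.
have := lie_alternating mu_lie (x + y).
rewrite (linear_funD _ _ (lie_linear_r mu_lie (x + y))).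
rewrite (linear_funD _ _ (lie_linear_l mu_lie x)).
rewrite (linear_funD _ _ (lie_linear_l mu_lie y)).
by rewrite !(lie_alternating mu_lie) add0r addr0 addrC.
Qed.

Lemma ad_bracket x y : ad mu (mu x y) = ad mu y *m ad mu x - ad mu x *m ad mu y.
Proof.
apply/row_matrixP => i; rewrite [in RHS]linearB /= !row_mul !rowE !mulmx_ad.
set z := delta_mx 0 i; have := lie_jacobi mu_lie x y z.
rewrite [mu z (mu x y)]bracketC => /eqP; rewrite subr_eq0 => /eqP <-.
by rewrite [mu z x]bracketC -scaleN1r (linear_funZ _ _ (lie_linear_r mu_lie y)) scaleN1r.
Qed.

Lemma ad_linear a x y : ad mu (a *: x + y) = a *: ad mu x + ad mu y.
Proof.
apply/row_matrixP => i; rewrite [in RHS]linearD [in RHS]linearZ /= !rowE !mulmx_ad.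
exact: (lie_linear_l mu_lie).
Qed.

Lemma mem_derived_space (U : {vspace 'rV[R]_n}) x y :
  x \in U -> y \in U -> mu x y \in derived_space mu U.
Proof.
move=> /coord_vbasis -> /coord_vbasis ->.
rewrite (linear_fun_sum _ _ _ (lie_linear_r mu_lie _)).
apply: memv_suml => j _; apply: memvZ.
rewrite (linear_fun_sum _ _ _ (lie_linear_l mu_lie _)).
apply: memv_suml => i _; apply/memvZ/memv_span.
by apply: allpairs_f; apply: mem_nth; rewrite size_tuple.
Qed.

Lemma derived_spaceS (U V : {vspace 'rV[R]_n}) : (U <= V)%VS -> (derived_space mu U <= derived_space mu V)%VS.
Proof.
move=> UV; apply/span_subvP => _ /allpairsP[[x y] /= [xU yU ->]].
by apply: mem_derived_space; apply: (subvP UV); apply: vbasis_mem.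
Qed.

Lemma derived_series_decr k :
  (iter k.+1 (derived_space mu) fullv <= iter k (derived_space mu) fullv)%VS.
Proof. by elim: k => [|k IH]; [exact: subvf | exact: derived_spaceS]. Qed.

Variables (C : numClosedFieldType) (f : {rmorphism R -> C}).

Let common_eigenvector_on m (rho : 'rV[R]_n -> 'M[C]_m) (U : {vspace 'rV[R]_n}) :=
  exists2 v : 'rV[C]_m, v != 0 & forall u, u \in U -> exists a, v *m rho u = a *: v.

(** Since the weight [l] vanishes on every [mu x u], its weight space is stable under [rho x], and
    an eigenvector of [rho x] in that space serves for [U] and [x] together. *)
Lemma common_eigenvector_step m (rho : 'rV[R]_n -> 'M[C]_m) (U : {vspace 'rV[R]_n}) x :
  lie_rep f mu rho -> (forall u, u \in U -> mu x u \in U) ->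
  common_eigenvector_on rho U -> common_eigenvector_on rho (U + <[x]>)%VS.
Proof.
move=> rep Ux [v vN0 vU].
have [l lE] : exists l, forall u, u \in U -> v *m rho u = l u *: v.
  have [|l lE] := @choice _ _ (fun u a => u \in U -> v *m rho u = a *: v).
    move=> u; case: (boolP (u \in U)) => [/vU[a aE]|_]; last by exists 0.
    by exists a.
  by exists l.
have l0 := weight_bracket rep Ux vN0 lE.
have [||w [a [wN0 wU wx]]] := @eigenvector_in_stable _ _ (rho x)
    (fun w => forall u, u \in U -> w *m rho u = l u *: w) v _ _ vN0 lE.
- move=> w wU u uU.
  have -> : w *m rho x *m rho u = w *m rho u *m rho x - w *m rho (mu x u).
    by rewrite (rep_bracket rep) mulmxBr opprB addrC !mulmxA subrK.
  by rewrite (wU u uU) (wU _ (Ux u uU)) (l0 u uU) scale0r subr0 scalemxAl.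
- move=> a w w' wU w'U u uU.
  by rewrite mulmxDl -scalemxAl wU // w'U // scalerDr !scalerA mulrC.
exists w => // _ /memv_addP[u uU [_ /vlineP[b ->] ->]].
exists (f b * a + l u); rewrite addrC (rep_linear rep) mulmxDr wU //.
by rewrite -scalemxAr wx scalerA scalerDl.
Qed.

(** Climb the derived series from 0. Between [derived_space mu D] and [D], basis vectors are added
    one at a time; every intermediate space contains all brackets of [D], so the previous lemma
    applies. *)
Lemma solvable_common_eigenvector m (rho : 'rV[R]_n -> 'M[C]_m.+1) :
  lie_solvable mu -> lie_rep f mu rho -> common_eigenvector_on rho fullv.
Proof.
move=> [k Dk0] rep.
suff step j : common_eigenvector_on rho (iter j.+1 (derived_space mu) fullv) ->
    common_eigenvector_on rho (iter j (derived_space mu) fullv).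
  have : common_eigenvector_on rho (iter k (derived_space mu) fullv).
    rewrite Dk0; exists (delta_mx 0 0).
      by apply/eqP => /rowP/(_ 0)/eqP; rewrite !mxE !eqxx oner_eq0.
    move=> u; rewrite memv0 => /eqP ->; exists 0.
    have := rep_linear rep (-1) 0 0.
    by rewrite scaler0 addr0 rmorphN1 scaleN1r addNr scale0r => ->; rewrite mulmx0.
  by elim: k {Dk0} => // k IH /step.
set D := iter j _ _ => PD'.
suff Ps s : {subset s <= D} ->
    common_eigenvector_on rho (derived_space mu D + <<s>>)%VS.
  have [v vN0 vU] := Ps (vbasis D) (fun x => @vbasis_mem _ _ x D).
  exists v => // u uD; apply: vU; apply: (subvP (addvSr _ _)).
  by rewrite (span_basis (vbasisP D)).
elim: s => [|x s IH] sD; first by rewrite span_nil addv0.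
have {}IH := IH (fun y ys => sD y (mem_behead (s := x :: s) ys)).
rewrite span_cons [(<[x]> + _)%VS]addvC addvA.
apply: common_eigenvector_step => // u uU.
apply: (subvP (addvSl _ _)); apply: mem_derived_space; first by apply/sD/mem_head.
apply: (subvP _ _ uU); apply/subvP => y /memv_addP[a aD [b bs ->]].
apply: memvD; first by apply: (subvP (derived_series_decr j)).
apply: (subvP _ _ bs); apply/span_subvP => z zs; apply: sD.
by rewrite in_cons zs orbT.
Qed.

(** With a common eigenvector as first basis vector the upper right block vanishes, so the lower
    right blocks form a representation on the quotient, of dimension one less. *)
Theorem lie_theorem m (rho : 'rV[R]_n -> 'M[C]_m) :
  lie_solvable mu -> lie_rep f mu rho ->
  exists P : 'M[C]_m, exists2 Q : 'M[C]_m, P *m Q = 1%:M & forall x, is_trig_mx (P *m rho x *m Q).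
Proof.
move=> sol; elim: m rho => [|m IH] rho rep.
  exists 1%:M, 1%:M; first by rewrite mul1mx.
  by move=> x; apply/is_trig_mxP => -[].
have [v vN0 vE] := solvable_common_eigenvector sol rep.
pose v1 : 'M[C]_(1 + m) := col_mx (v : 'rV_(1 + m)) 0.
have v1E : delta_mx 0 0 *m v1 = v :> 'rV_(1 + m).
  rewrite -rowE; apply/rowP => j; rewrite !mxE.
  by case: splitP => // i _; rewrite ord1.
have [|g gu gE] := @complete_unitmx C 1 (1 + m) (delta_mx 0 0) v1.
  by rewrite v1E mxrank_delta rank_rV vN0.
have {}gE : row 0 g = v.
  by rewrite rowE -gE.
pose A x : 'M[C]_(1 + m) := g *m rho x *m invmx g.
have Aur x : ursubmx (A x) = 0.
  have [a aE] := vE x (memvf x).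
  have A0 : row 0 (A x) = a *: delta_mx 0 0.
    by rewrite !row_mul gE aE -gE -scalemxAl rowE mulmxK.
  apply/matrixP => i j; rewrite ord1 !mxE.
  move/rowP/(_ (rshift 1 j)): A0; rewrite !mxE.
  have -> : lshift m 0 = 0 :> 'I_(1 + m) by apply/val_inj.
  by rewrite andbF mulr0.
have Amul x y : A x *m A y = g *m (rho x *m rho y) *m invmx g.
  by rewrite /A !mulmxA mulmxKV.
have Adr x y : drsubmx (A x *m A y) = drsubmx (A x) *m drsubmx (A y).
  rewrite -[A x]submxK -[A y]submxK mulmx_block !Aur !block_mxKdr.
  by rewrite mulmx0 add0r.
have rep' : lie_rep f mu (fun x => drsubmx (A x)).
  split=> [a x y|x y].
    rewrite /A (rep_linear rep) mulmxDr mulmxDl -scalemxAr -scalemxAl.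
    by apply/matrixP => i j; rewrite !mxE.
  rewrite -!Adr !Amul /A (rep_bracket rep) mulmxBr mulmxBl.
  by apply/matrixP => i j; rewrite !mxE.
have [P [Q PQ trig]] := IH _ rep'.
pose P1 : 'M[C]_(1 + m) := block_mx 1%:M 0 0 P.
pose Q1 : 'M[C]_(1 + m) := block_mx 1%:M 0 0 Q.
have PQ1 : (P1 *m g) *m (invmx g *m Q1) = 1%:M.
  rewrite mulmxA mulmxK // mulmx_block !mulmx0 !mul0mx !addr0 !add0r mul1mx PQ.
  by rewrite -scalar_mx_block.
have trig1 x : is_trig_mx (P1 *m A x *m Q1 : 'M[C]_(1 + m)).
  rewrite -[A x]submxK Aur !mulmx_block !mulmx0 !mul0mx !addr0 !add0r.
  rewrite mul1mx mulmx1 is_trig_block_mx // mul0mx eqxx mx11_is_trig /=.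
  exact: trig.
exists (P1 *m g), (invmx g *m Q1) => // x.
have -> : P1 *m g *m rho x *m (invmx g *m Q1) = P1 *m A x *m Q1.
  by rewrite /A !mulmxA.
exact: trig1.
Qed.

End DerivedSeries.

(** * Weights and Lie algebras of real type *)

(** Lagrange's identity: twice the defect is the sum of the squares of the 2 x 2 minors. *)
Lemma cauchy_schwarz (R : realFieldType) (I : finType) (a b : I -> R) :
  (\sum_i a i * b i) ^+ 2 <= (\sum_i a i ^+ 2) * (\sum_i b i ^+ 2).
Proof.
have : 0 <= \sum_i \sum_j (a i * b j - a j * b i) ^+ 2.
  by apply: sumr_ge0 => i _; apply: sumr_ge0 => j _; apply: sqr_ge0.
suff -> : \sum_i \sum_j (a i * b j - a j * b i) ^+ 2 =
   (\sum_i a i ^+ 2) * (\sum_i b i ^+ 2) *+ 2 - (\sum_i a i * b i) ^+ 2 *+ 2.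
  by rewrite -mulrnBl pmulrn_lge0 // subr_ge0.
have E (f g : I -> R) : \sum_i \sum_j f i * g j = (\sum_i f i) * (\sum_i g i).
  by rewrite mulr_suml; apply: eq_bigr => i _; rewrite mulr_sumr.
have E' (f g : I -> R) : \sum_i \sum_j f j * g i = (\sum_i f i) * (\sum_i g i).
  by rewrite exchange_big /= E.
rewrite mulr2n -{1}E -E' expr2 -E -mulNrn mulr2n -!sumrN -!big_split /=.
apply: eq_bigr => i _ /=.
rewrite -!sumrN -!big_split; apply: eq_bigr => j _ /=; ring.
Qed.

Lemma trig_mulmx_diag (C : comNzRingType) (n : nat) (A B : 'M[C]_n) i :
  is_trig_mx A -> is_trig_mx B -> (A *m B) i i = A i i * B i i.
Proof.
move=> /is_trig_mxP tA /is_trig_mxP tB; rewrite mxE (bigD1 i) //= big1 ?addr0 //.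
move=> j ji; have [ij|{}ji|/val_inj e] := ltngtP i j.
- by rewrite tA // mul0r.
- by rewrite tB // mulr0.
- by rewrite e eqxx in ji.
Qed.

Definition sym_sqnorm (R : realType) (n : nat) (A : 'M[R]_n) : R :=
  \sum_i \sum_j ((A i j + A j i) / 2) ^+ 2.

Lemma sym_sqnormE (R : realType) (n : nat) (A : 'M[R]_n) :
  sym_sqnorm A = (\tr (A *m A) + \tr (A *m A^T)) / 2.
Proof.
have -> : \tr (A *m A) = \sum_i \sum_j A i j * A j i.
  by apply: eq_bigr => i _; rewrite mxE.
have -> : \tr (A *m A^T) = \sum_i \sum_j A i j ^+ 2.
  by apply: eq_bigr => i _; rewrite mxE; apply: eq_bigr => j _; rewrite mxE.
rewrite /sym_sqnorm.
have -> : \sum_i \sum_j A i j ^+ 2 =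
    (\sum_i \sum_j A i j ^+ 2 + \sum_i \sum_j A j i ^+ 2) / 2.
  by rewrite [X in _ + X]exchange_big /=; field.
rewrite -big_split /= mulr_suml -big_split /= mulr_suml.
apply: eq_bigr => i _; rewrite -big_split /= mulr_suml -big_split /= mulr_suml.
by apply: eq_bigr => j _; field.
Qed.

Lemma sym_sqnorm_ge0 (R : realType) (n : nat) (A : 'M[R]_n) : 0 <= sym_sqnorm A.
Proof. by apply: sumr_ge0 => i _; apply: sumr_ge0 => j _; apply: sqr_ge0. Qed.

Lemma Re_sum (R : realType) (I : Type) (r : seq I) (F : I -> R[i]) :
  complex.Re (\sum_(i <- r) F i) = \sum_(i <- r) complex.Re (F i).
Proof. by apply: (big_morph (@complex.Re R)) => // -[a b] [c d]. Qed.

Lemma Im_sum (R : realType) (I : Type) (r : seq I) (F : I -> R[i]) :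
  complex.Im (\sum_(i <- r) F i) = \sum_(i <- r) complex.Im (F i).
Proof. by apply: (big_morph (@complex.Im R)) => // -[a b] [c d]. Qed.

(** For an eigenvector a + i b, Re z (|a|^2 + |b|^2) is the pairing of the symmetric part of [A]
    with the matrix a a^T + b b^T, whose norm is at most |a|^2 + |b|^2. *)
Lemma eigenvalue_Re_sqr_le (R : realType) (n : nat) (A : 'M[R]_n) (z : R[i]) :
  eigenvalue (map_mx (real_complex R) A) z -> complex.Re z ^+ 2 <= sym_sqnorm A.
Proof.
case/eigenvalueP=> v vE vN0.
pose a j := complex.Re (v 0 j); pose b j := complex.Im (v 0 j).
have aE j : \sum_k a k * A k j = complex.Re z * a j - complex.Im z * b j.
  move/rowP/(_ j)/(congr1 (@complex.Re R)): vE; rewrite !mxE Re_sum.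
  move=> e; transitivity (complex.Re (z * v 0 j)).
    rewrite -e; apply: eq_bigr => k _; rewrite mxE /a.
    by case: (v 0 k) => x y /=; rewrite mulr0 subr0.
  by rewrite /a /b; case: (z) (v 0 j) => [x y] [x' y'].
have bE j : \sum_k b k * A k j = complex.Im z * a j + complex.Re z * b j.
  move/rowP/(_ j)/(congr1 (@complex.Im R)): vE; rewrite !mxE Im_sum.
  move=> e; transitivity (complex.Im (z * v 0 j)).
    rewrite -e; apply: eq_bigr => k _; rewrite mxE /b.
    by case: (v 0 k) => x y /=; rewrite mulr0 add0r.
  by rewrite /a /b; case: (z) (v 0 j) => [x y] [x' y'] /=; rewrite addrC.
pose p := \sum_i a i ^+ 2; pose q := \sum_i b i ^+ 2; pose r := \sum_i a i * b i.
have pq : complex.Re z * (p + q) =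
    \sum_(ij : 'I_n * 'I_n) (A ij.1 ij.2 + A ij.2 ij.1) / 2 * (a ij.1 * a ij.2 + b ij.1 * b ij.2).
  rewrite -(pair_bigA _ (fun i j => (A i j + A j i) / 2 * (a i * a j + b i * b j))) /=.
  transitivity (\sum_j \sum_k (a k * A k j * a j + b k * A k j * b j)).
    rewrite /p /q -big_split /= mulr_sumr; apply: eq_bigr => j _.
    by rewrite big_split /= -!mulr_suml aE bE; ring.
  transitivity ((\sum_j \sum_k (a k * A k j * a j + b k * A k j * b j)
     + \sum_k \sum_j (a k * A k j * a j + b k * A k j * b j)) / 2).
    by rewrite [X in _ + X]exchange_big /=; field.
  rewrite -big_split /= mulr_suml; apply: eq_bigr => i _.
  by rewrite -big_split /= mulr_suml; apply: eq_bigr => j _; field.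
have p_ge0 : 0 <= p by apply: sumr_ge0 => i _; apply: sqr_ge0.
have q_ge0 : 0 <= q by apply: sumr_ge0 => i _; apply: sqr_ge0.
have pq_gt0 : 0 < p + q.
  rewrite lt0r addr_ge0 // andbT paddr_eq0 //; apply: contra vN0.
  rewrite !psumr_eq0; try by move=> i _; apply: sqr_ge0.
  move=> /andP[/allP p0 /allP q0]; apply/eqP/rowP => j; apply/eqP.
  have := p0 j (mem_index_enum j); have := q0 j (mem_index_enum j).
  by rewrite /= !sqrf_eq0 mxE eq_complex => -> ->.
have : (complex.Re z * (p + q)) ^+ 2 <= sym_sqnorm A * (p + q) ^+ 2.
  rewrite pq; apply: le_trans (cauchy_schwarz _ _) _.
  rewrite -(pair_bigA _ (fun i j => ((A i j + A j i) / 2) ^+ 2)) /=.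
  apply: ler_wpM2l; first exact: sym_sqnorm_ge0.
  rewrite -(pair_bigA _ (fun i j => (a i * a j + b i * b j) ^+ 2)) /=.
  have -> : \sum_i \sum_j (a i * a j + b i * b j) ^+ 2 = p ^+ 2 + r ^+ 2 *+ 2 + q ^+ 2.
    rewrite !expr2 mulr_suml [r * r]mulr_suml [q * q]mulr_suml -sumrMnl -!big_split /=.
    apply: eq_bigr => i _; rewrite !mulr_sumr -sumrMnl -!big_split /=.
    by apply: eq_bigr => j _; ring.
  have : r ^+ 2 <= p * q by exact: cauchy_schwarz.
  by rewrite -subr_ge0 => h; rewrite -subr_ge0; lra.
by rewrite exprMn ler_pM2r // exprn_gt0.
Qed.

Section Weights.
Variables (R : realType) (n : nat) (mu : bracket R n).
Hypotheses (mu_lie : is_lie_bracket mu) (mu_sol : lie_solvable mu).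

Lemma ad_lie_rep :
  lie_rep (real_complex R) mu (fun x => map_mx (real_complex R) (ad mu x)).
Proof.
split=> [a x y|x y].
  by rewrite (ad_linear mu_lie) map_mxD map_mxZ.
by rewrite (ad_bracket mu_lie) map_mxB !map_mxM.
Qed.

Lemma mxtrace_ad_mul (P Q : 'M[R[i]]_n) x y :
  P *m Q = 1%:M -> (forall x, is_trig_mx (P *m map_mx (real_complex R) (ad mu x) *m Q)) ->
  real_complex R (\tr (ad mu x *m ad mu y)) =
  \sum_i (P *m map_mx (real_complex R) (ad mu x) *m Q) i i
       * (P *m map_mx (real_complex R) (ad mu y) *m Q) i i.
Proof.
move=> PQ trig; rewrite -trace_map_mx map_mxM.
set X := map_mx _ (ad mu x); set Y := map_mx _ (ad mu y).
have -> : \tr (X *m Y) = \tr ((P *m X *m Q) *m (P *m Y *m Q)).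
  rewrite !mulmxA -[_ *m Q *m P]mulmxA (mulmx1C PQ) mulmx1 [RHS]mxtrace_mulC.
  by rewrite !mulmxA (mulmx1C PQ) mul1mx.
by rewrite /mxtrace; apply: eq_bigr => i _; rewrite (trig_mulmx_diag _ (trig x) (trig y)).
Qed.

(** In triangular form the diagonal of a commutator is zero: weights vanish on brackets. This is the
    direction of Cartan's criterion that is used. *)
Lemma killing_derived x y z : \tr (ad mu (mu y z) *m ad mu x) = 0.
Proof.
have [P [Q PQ trig]] := lie_theorem mu_lie mu_sol ad_lie_rep.
have := mxtrace_ad_mul (mu y z) x PQ trig.
rewrite big1 => [/eqP|i _]; first by rewrite fmorph_eq0 => /eqP.
rewrite (rep_bracket ad_lie_rep) mulmxBr mulmxBl.
have E u v : P *m (map_mx (real_complex R) (ad mu u) *m map_mx (real_complex R) (ad mu v)) *m Q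
  = (P *m map_mx (real_complex R) (ad mu u) *m Q) *m (P *m map_mx (real_complex R) (ad mu v) *m Q).
  by rewrite !mulmxA -[_ *m Q *m P]mulmxA (mulmx1C PQ) mulmx1.
rewrite [_ i i]mxE [X in _ + X]mxE !E !(trig_mulmx_diag _ (trig _) (trig _)).
by rewrite [X in _ - X]mulrC subrr mul0r.
Qed.

Lemma spec_similar_trig (A P Q : 'M[R[i]]_n) z :
  P *m Q = 1%:M -> is_trig_mx (P *m A *m Q) ->
  eigenvalue A z = [exists i, z == (P *m A *m Q) i i].
Proof.
move=> PQ trig; transitivity (eigenvalue (P *m A *m Q) z).
  have QP := mulmx1C PQ; apply/eigenvalueP/eigenvalueP=> [] [v vE vN0].
    exists (v *m Q); last first.
      by apply: contra vN0 => /eqP e; rewrite -[v]mulmx1 -QP mulmxA e mul0mx.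
    by rewrite !mulmxA -[_ *m Q *m P]mulmxA QP mulmx1 vE -scalemxAl.
  exists (v *m P); last first.
    by apply: contra vN0 => /eqP e; rewrite -[v]mulmx1 -PQ mulmxA e mul0mx.
  rewrite scalemxAl -vE !mulmxA -[_ *m Q *m P]mulmxA QP mulmx1 //.
rewrite eigenvalue_root_char char_poly_trig // rootE horner_prod.
apply/idP/existsP => [/prodf_eq0[i _]|[i /eqP ->]].
  by rewrite hornerXsubC subr_eq0; exists i.
by apply/prodf_eq0; exists i; rewrite // hornerXsubC subrr.
Qed.

Lemma nilpotent_eigenvalue (A : 'M[R]_n) z :
  nilpotent_mx A -> eigenvalue (map_mx (real_complex R) A) z -> z = 0.
Proof.
move=> [k Ak0] /eigenvalueP[v vE vN0].
have : v *m map_mx (real_complex R) (A ^+ k) = z ^+ k *: v.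
  elim: k {Ak0} => [|k IH]; first by rewrite !expr0 map_mx1 mulmx1 scale1r.
  by rewrite exprSr map_mxM mulmxA IH -scalemxAl vE scalerA exprSr.
rewrite Ak0 map_mx0 mulmx0 => /esym/eqP.
by rewrite scaler_eq0 (negPf vN0) orbF expf_eq0 => /andP[_ /eqP].
Qed.

(* Real type says that the real parts of the weights have no more common
   zeros than the weights themselves, so that the imaginary parts are linear
   combinations of the real ones. *)
Lemma real_type_killing_bound :
  real_type mu -> exists2 c, 0 <= c & forall (g h A : 'M[R]_n) x, g *m h = 1%:M ->
    A = g *m ad mu x *m h -> - \tr (A *m A) <= c * sym_sqnorm A.
Proof.
move=> real.
have [P [Q PQ trig]] := lie_theorem mu_lie mu_sol ad_lie_rep.
pose T x := P *m map_mx (real_complex R) (ad mu x) *m Q.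
pose Ra : 'M[R]_n := \matrix_(k, i) complex.Re (T (delta_mx 0 k) i i).
pose Ia : 'M[R]_n := \matrix_(k, i) complex.Im (T (delta_mx 0 k) i i).
have Tlin x : T x = \sum_k (x 0 k)%:C%C *: T (delta_mx 0 k).
  rewrite {1}[x]row_sum_delta /T.
  have -> : ad mu (\sum_k x 0 k *: delta_mx 0 k) = \sum_k x 0 k *: ad mu (delta_mx 0 k).
    by rewrite (linear_fun_sum _ _ _ (fun a x y => ad_linear mu_lie a x y)).
  rewrite map_mx_sum mulmx_sumr mulmx_suml; apply: eq_bigr => k _.
  by rewrite map_mxZ -scalemxAr -scalemxAl.
have Re_T x i : complex.Re (T x i i) = (x *m Ra) 0 i.
  rewrite Tlin summxE Re_sum mxE; apply: eq_bigr => k _; rewrite [(_ *: T _) i i]mxE [Ra k i]mxE.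
  by case: (T _ i i) => a b /=; rewrite mul0r subr0.
have Im_T x i : complex.Im (T x i i) = (x *m Ia) 0 i.
  rewrite Tlin summxE Im_sum mxE; apply: eq_bigr => k _; rewrite [(_ *: T _) i i]mxE [Ia k i]mxE.
  by case: (T _ i i) => a b /=; rewrite mul0r addr0.
(* If all weights of [x] are imaginary, real type makes [ad mu x] nilpotent, so they are all 0. *)
have ker (x : 'rV[R]_n) : x *m Ra = 0 -> x *m Ia = 0.
  move=> xR; apply/rowP => i; rewrite -Im_T; transitivity (0 : R); last by rewrite mxE.
  have eig : eigenvalue (map_mx (real_complex R) (ad mu x)) (T x i i).
    rewrite (spec_similar_trig _ PQ (trig x)); apply/existsP; exists i; exact: eqxx.
  case: (real x) => [nil|[]]; first by rewrite (nilpotent_eigenvalue nil eig).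
  move=> z; rewrite /spec /imaginary_axis /= (spec_similar_trig _ PQ (trig x)).
  by move=> /existsP[j /eqP ->]; rewrite -/(T x) Re_T xR mxE.
have [W WE] : exists W, Ia = Ra *m W.
  suff /submxP[W WE] : (Ia^T <= Ra^T)%MS.
    by exists W^T; apply: trmx_inj; rewrite WE trmx_mul trmxK.
  rewrite submxE; apply/eqP/matrixP => i j; rewrite [RHS]mxE.
  have /ker/(congr1 trmx) : (col j (cokermx Ra^T))^T *m Ra = 0.
    by apply: trmx_inj; rewrite trmx_mul trmxK colE mulmxA mulmx_coker mul0mx trmx0.
  rewrite trmx_mul trmxK trmx0 [in X in X = _ -> _]colE mulmxA -colE => /colP/(_ i).
  by rewrite [col _ _ _ _]mxE [in X in _ = X -> _]mxE.
pose c := \sum_i \sum_j W i j ^+ 2.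
have c_ge0 : 0 <= c by apply: sumr_ge0 => i _; apply: sumr_ge0 => j _; apply: sqr_ge0.
(* [c] is the squared norm of [W] and comes from Cauchy-Schwarz; the factor [n] counts the weights,
   each with squared real part at most [sym_sqnorm A]. Both are fixed before [g] and [h]. *)
exists (n%:R * c) => [|g h A x gh AE]; first by rewrite mulr_ge0 ?ler0n.
have -> : \tr (A *m A) = \sum_i (complex.Re (T x i i) ^+ 2 - complex.Im (T x i i) ^+ 2).
  have -> : \tr (A *m A) = \tr (ad mu x *m ad mu x).
    rewrite AE !mulmxA -[_ *m h *m g]mulmxA (mulmx1C gh) mulmx1 mxtrace_mulC.
    by rewrite !mulmxA (mulmx1C gh) mul1mx.
  have /(congr1 (@complex.Re R)) /= -> := mxtrace_ad_mul x x PQ trig.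
  rewrite Re_sum; apply: eq_bigr => i _; rewrite -/(T x).
  by case: (T x i i) => a b; rewrite /= !expr2.
have eigA i : complex.Re (T x i i) ^+ 2 <= sym_sqnorm A.
  apply: eigenvalue_Re_sqr_le.
  have eig : eigenvalue (map_mx (real_complex R) (ad mu x)) (T x i i).
    rewrite (spec_similar_trig _ PQ (trig x)); apply/existsP; exists i; exact: eqxx.
  case/eigenvalueP: eig => v vE vN0; apply/eigenvalueP.
  pose gC := map_mx (real_complex R) g; pose hC := map_mx (real_complex R) h.
  have hg : hC *m gC = 1%:M by rewrite -map_mxM (mulmx1C gh) map_mx1.
  exists (v *m hC); last first.
    by apply: contra vN0 => /eqP e; rewrite -[v]mulmx1 -hg mulmxA e mul0mx.
  by rewrite AE !map_mxM -/gC -/hC !mulmxA -[_ *m hC *m gC]mulmxA hg mulmx1 vE scalemxAl.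
have Im_le : \sum_i complex.Im (T x i i) ^+ 2 <= c * \sum_i complex.Re (T x i i) ^+ 2.
  rewrite /c exchange_big /= mulr_suml; apply: ler_sum => i _.
  rewrite mulrC Im_T WE mulmxA mxE; under [X in _ <= X * _]eq_bigr do rewrite Re_T.
  exact: cauchy_schwarz.
rewrite sumrB opprB lerBlDr; apply: (le_trans Im_le).
rewrite [n%:R * c]mulrC -mulrA; apply: le_trans (_ : c * (n%:R * sym_sqnorm A) <= _).
  apply: ler_wpM2l => //.
  have -> : n%:R * sym_sqnorm A = \sum_(i < n) sym_sqnorm A.
    by rewrite sumr_const card_ord mulr_natl.
  exact: ler_sum.
by rewrite lerDl; apply: sumr_ge0 => i _; apply: sqr_ge0.
Qed.

End Weights.

(** * Curvature in terms of the structure constants *)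

Section Curvature.
Variables (R : realType) (n : nat) (mu : bracket R n).

Definition struct_const (i j k : 'I_n) : R :=
  mu (basis_vec R i) (basis_vec R j) 0 k.

Definition christoffel (i j k : 'I_n) : R :=
  (struct_const i j k - struct_const j k i + struct_const k i j) / 2.

Hypotheses (mu_l : forall y, linear (mu^~ y)) (mu_r : forall x, linear (mu x)).

Lemma dotv_linear_l (y : 'rV[R]_n) : linear (fun x => dotv x y : R^o).
Proof.
move=> a u v; rewrite /dotv scaler_sumr -big_split; apply: eq_bigr => i _ /=.
by rewrite !mxE mulrDl -mulrA.
Qed.

Lemma dotv_linear_r (x : 'rV[R]_n) : linear (fun y => dotv x y : R^o).
Proof.
move=> a u v; rewrite /dotv scaler_sumr -big_split; apply: eq_bigr => i _ /=.
by rewrite !mxE mulrDr; congr (_ + _); rewrite mulrCA.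
Qed.

Lemma dotv_basis (x : 'rV[R]_n) k : dotv x (basis_vec R k) = x 0 k.
Proof.
rewrite /dotv (bigD1 k) //= big1 => [|i ik]; rewrite mxE eqxx /=.
  by rewrite eqxx mulr1 addr0.
by rewrite (negPf ik) mulr0.
Qed.

Lemma dotvC (x y : 'rV[R]_n) : dotv x y = dotv y x.
Proof. by apply: eq_bigr => i _; rewrite mulrC. Qed.

Lemma dotv_nabla x y z : dotv (nabla mu x y) z =
  2^-1 * (dotv (mu x y) z - dotv (mu y z) x + dotv (mu z x) y).
Proof.
pose g w : R^o := 2^-1 * (dotv (mu x y) w - dotv (mu y w) x + dotv (mu w x) y).
have gl : linear g.
  move=> a u v; rewrite /g [mu y _]mu_r (dotv_linear_r _ a u v) (dotv_linear_l x a _ _).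
  have -> : mu (a *: u + v) x = a *: mu u x + mu v x by exact: mu_l.
  rewrite (dotv_linear_l y a _ _) /GRing.scale /=; ring.
rewrite -[RHS]/(g z) [z]row_sum_delta (linear_fun_sum _ _ _ gl).
rewrite (linear_fun_sum _ _ _ (dotv_linear_r _)).
by apply: eq_bigr => k _; rewrite -/(basis_vec R k) dotv_basis mxE.
Qed.

Lemma dotvP (x y : 'rV[R]_n) : (forall z, dotv x z = dotv y z) -> x = y.
Proof. by move=> e; apply/rowP => k; rewrite -!dotv_basis. Qed.

Lemma nabla_linear_r x : linear (nabla mu x).
Proof.
move=> a u v; apply/rowP => k; rewrite -!dotv_basis.
rewrite (dotv_linear_l _ a _ _) !dotv_nabla.
have -> : mu x (a *: u + v) = a *: mu x u + mu x v by exact: mu_r.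
set b := basis_vec R k.
have -> : mu (a *: u + v) b = a *: mu u b + mu v b by exact: mu_l.
rewrite !(dotv_linear_l _ a _ _) (dotv_linear_r _ a _ _) /GRing.scale /=; ring.
Qed.

Lemma nabla_linear_l y : linear (nabla mu ^~ y).
Proof.
move=> a u v /=; apply/rowP => k; rewrite -!dotv_basis.
rewrite (dotv_linear_l _ a _ _) !dotv_nabla.
set b := basis_vec R k.
have -> : mu (a *: u + v) y = a *: mu u y + mu v y by exact: mu_l.
have -> : mu b (a *: u + v) = a *: mu b u + mu b v by exact: mu_r.
rewrite !(dotv_linear_l _ a _ _) (dotv_linear_r _ a _ _) /GRing.scale /=; ring.
Qed.

Lemma nabla_basis i j k :
  nabla mu (basis_vec R i) (basis_vec R j) 0 k = christoffel i j k.
Proof. by rewrite mxE !dotv_basis mulrC. Qed.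

Lemma row_sum_basis (x : 'rV[R]_n) : x = \sum_k x 0 k *: basis_vec R k.
Proof. exact: row_sum_delta. Qed.

Lemma curvature_basis i j k l :
  curvature mu (basis_vec R i) (basis_vec R j) (basis_vec R k) 0 l =
  \sum_m (christoffel j k m * christoffel i m l
          - christoffel i k m * christoffel j m l
          - struct_const i j m * christoffel m k l).
Proof.
rewrite /curvature mxE [X in X + _]mxE [X in _ + X + _]mxE [X in _ + X]mxE.
rewrite {1}[nabla mu (basis_vec R j) _]row_sum_basis (linear_fun_sum _ _ _ (nabla_linear_r _)).
rewrite {1}[nabla mu (basis_vec R i) (basis_vec R k)]row_sum_basis.
rewrite (linear_fun_sum _ _ _ (nabla_linear_r _)).
rewrite [mu _ _]row_sum_basis (linear_fun_sum _ _ _ (nabla_linear_l _)).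
rewrite !summxE -!sumrN -!big_split /=; apply: eq_bigr => m _.
have sE a (v : 'rV[R]_n) : (a *: v) 0 l = a * v 0 l by rewrite mxE.
by rewrite !sE !nabla_basis.
Qed.

Lemma RicE i j : Ric mu i j = \sum_k \sum_m
  (christoffel i j m * christoffel k m k - christoffel k j m * christoffel i m k
   - struct_const k i m * christoffel m j k).
Proof.
rewrite mxE; apply: eq_bigr => k _; rewrite dotv_basis; exact: curvature_basis.
Qed.

Definition bracket_sqnorm : R := \sum_i \sum_j \sum_k struct_const i j k ^+ 2.

Definition killing_trace : R :=
  \sum_i \sum_j \sum_k struct_const i j k * struct_const i k j.

Definition mean_curv (i : 'I_n) : R := \sum_k struct_const i k k.

(** Summing over all orders of the indices turns an identity between triple sums into a termwise one
    that [field] can decide. *)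
Lemma sum3_symm (f : 'I_n -> 'I_n -> 'I_n -> R) :
  (\sum_i \sum_j \sum_k f i j k) *+ 6 = \sum_i \sum_j \sum_k
    (f i j k + f i k j + f j i k + f j k i + f k i j + f k j i).
Proof.
have s12 (g : 'I_n -> 'I_n -> 'I_n -> R) : \sum_i \sum_j \sum_k g i j k = \sum_i \sum_j \sum_k g j i k :> R.
  by rewrite exchange_big.
have s23 (g : 'I_n -> 'I_n -> 'I_n -> R) : \sum_i \sum_j \sum_k g i j k = \sum_i \sum_j \sum_k g i k j :> R.
  by apply: eq_bigr => i _; rewrite exchange_big.
have D (g h : 'I_n -> 'I_n -> 'I_n -> R) : \sum_i \sum_j \sum_k (g i j k + h i j k) =
   \sum_i \sum_j \sum_k g i j k + \sum_i \sum_j \sum_k h i j k :> R.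
  rewrite -big_split; apply: eq_bigr => i _; rewrite -big_split.
  by apply: eq_bigr => j _; rewrite -big_split.
rewrite !D.
rewrite -(s23 f) -(s12 f).
rewrite -(s12 (fun i j k => f i k j)) -(s23 f).
rewrite -(s23 (fun i j k => f j i k)) -(s12 f).
rewrite -(s12 (fun i j k => f k i j)) -(s23 (fun i j k => f j i k)) -(s12 f).
by rewrite !mulrS mulr0n addr0 !addrA.
Qed.

Hypothesis mu_alt : forall x, mu x x = 0.

Lemma struct_constC i j k : struct_const i j k = - struct_const j i k.
Proof.
apply/eqP; rewrite -addr_eq0; apply/eqP.
have /rowP/(_ k) := mu_alt (basis_vec R i + basis_vec R j).
rewrite (linear_funD _ _ (mu_r _)) (linear_funD _ _ (mu_l _)).
by rewrite (linear_funD _ _ (mu_l _)) !mu_alt !mxE add0r addr0 addrC.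
Qed.

Lemma struct_const_diag i k : struct_const i i k = 0.
Proof. by rewrite /struct_const mu_alt mxE. Qed.

(** The products of two contracted Christoffel symbols give the mean curvature term; the rest is
    compared after symmetrisation, hence the factor 6. *)
Lemma ScalE :
  Scal mu = - \sum_i mean_curv i ^+ 2 - killing_trace / 2 - bracket_sqnorm / 4.
Proof.
rewrite /Scal /mxtrace; under eq_bigr do rewrite RicE.
pose c := struct_const; pose G := christoffel.
transitivity (\sum_i \sum_k \sum_m G i i m * G k m k
   - \sum_i \sum_k \sum_m (G k i m * G i m k + c k i m * G m i k)).
  rewrite -sumrB; apply: eq_bigr => i _; rewrite -sumrB; apply: eq_bigr => k _.
  by rewrite -sumrB; apply: eq_bigr => m _; rewrite opprD addrA.
rewrite -addrA -[- (_ / 2) - _]opprD; congr (_ - _).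
  under eq_bigr do rewrite exchange_big /=.
  rewrite exchange_big -sumrN; apply: eq_bigr => m _ /=.
  under eq_bigr do rewrite -mulr_sumr; rewrite -mulr_suml.
  have -> : \sum_i G i i m = mean_curv m.
    apply: eq_bigr => i _; rewrite /G /christoffel struct_const_diag.
    by rewrite [struct_const i m i]struct_constC; field.
  have -> : \sum_i G i m i = - mean_curv m.
    rewrite -sumrN; apply: eq_bigr => i _; rewrite /G /christoffel struct_const_diag.
    by rewrite [struct_const i m i]struct_constC; field.
  by rewrite mulrN expr2.
apply: (mulIf (_ : 6%:R != 0 :> R)); first by rewrite pnatr_eq0.
rewrite !mulr_natr mulrnDl -!mulrnAl /killing_trace /bracket_sqnorm !sum3_symm.
rewrite !mulr_suml -big_split; apply: eq_bigr => i _ /=.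
rewrite !mulr_suml -big_split; apply: eq_bigr => k _ /=.
rewrite !mulr_suml -big_split; apply: eq_bigr => m _ /=.
rewrite /G /c /christoffel.
rewrite [struct_const k i m]struct_constC [struct_const m i k]struct_constC.
rewrite [struct_const m k i]struct_constC; by field.
Qed.

Lemma struct_const_sqr_le i j k : struct_const i j k ^+ 2 <= bracket_sqnorm.
Proof.
have ge0 := fun a b c => sqr_ge0 (struct_const a b c).
rewrite /bracket_sqnorm (bigD1 i) //= (bigD1 j) //= (bigD1 k) //= -!addrA lerDl.
by rewrite !addr_ge0 //; do ![apply: sumr_ge0 => ? _ //].
Qed.

(** With m^2 = [bracket_sqnorm], structure constants are at most m and Christoffel symbols at most
    3/2 m, so each of the n^2 summands of Ric is at most (9/4 + 9/4 + 3/2) m^2 = 6 m^2. *)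
Lemma Ric_sqr_le i j : Ric mu i j ^+ 2 <= (6 * n%:R ^+ 2 * bracket_sqnorm) ^+ 2.
Proof.
pose m := Num.sqrt bracket_sqnorm.
have T_ge0 : 0 <= bracket_sqnorm.
  by do 3![apply: sumr_ge0 => ? _]; apply: sqr_ge0.
have m2 : m * m = bracket_sqnorm by rewrite -expr2 sqr_sqrtr.
have m_ge0 : 0 <= m by apply: sqrtr_ge0.
have cm a b c : `|struct_const a b c| <= m.
  by rewrite -sqrtr_sqr ler_wsqrtr // struct_const_sqr_le.
have Gm a b c : `|christoffel a b c| <= 3 / 2 * m.
  have := cm a b c; have := cm b c a; have := cm c a b.
  rewrite /christoffel !ler_norml; lra.
rewrite -real_normK ?num_real // ler_pXn2r ?nnegrE // ?mulr_ge0 ?exprn_ge0 //.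
rewrite RicE; apply: (le_trans (ler_norm_sum _ _ _)).
have -> : 6 * n%:R ^+ 2 * bracket_sqnorm = \sum_(k < n) \sum_(l < n) 6 * bracket_sqnorm.
  by rewrite !sumr_const card_ord -mulrnA -[RHS]mulr_natl natrM; ring.
apply: ler_sum => k _; apply: (le_trans (ler_norm_sum _ _ _)); apply: ler_sum => l _.
have P a b x y : `|a| <= x -> `|b| <= y -> `|a * b| <= x * y :> R.
  by move=> ha hb; rewrite normrM ler_pM.
have h1 := P _ _ _ _ (Gm i j l) (Gm k l k).
have h2 := P _ _ _ _ (Gm k j l) (Gm i l k).
have h3 := P _ _ _ _ (cm k i l) (Gm l j k).
have E1 : 3 / 2 * m * (3 / 2 * m) = 9 / 4 * bracket_sqnorm by rewrite -m2; field.
have E2 : m * (3 / 2 * m) = 3 / 2 * bracket_sqnorm by rewrite -m2; field.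
rewrite E1 in h1 h2; rewrite E2 in h3.
move: h1 h2 h3; rewrite !ler_norml; lra.
Qed.

Hypothesis mu_jacobi : forall x y z, mu x (mu y z) + mu y (mu z x) + mu z (mu x y) = 0.

Lemma mu_anti x y : mu x y = - mu y x.
Proof.
apply/eqP; rewrite -addr_eq0; apply/eqP.
have := mu_alt (x + y).
rewrite (linear_funD _ _ (mu_r _)) (linear_funD _ _ (mu_l _)).
by rewrite (linear_funD _ _ (mu_l _)) !mu_alt add0r addr0 addrC.
Qed.

Lemma nabla_torsion x y : nabla mu x y = nabla mu y x + mu x y.
Proof.
apply: dotvP => z; rewrite (linear_funD _ _ (dotv_linear_l z)) /= !dotv_nabla.
rewrite [mu y x]mu_anti [mu x z]mu_anti [mu z y]mu_anti.
have N u v : dotv (- u) v = - dotv (n := n) u v :> R.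
  by rewrite /dotv -sumrN; apply: eq_bigr => i _; rewrite mxE mulNr.
by rewrite !N; field.
Qed.

Lemma dotv_nabla_anti x y z : dotv (nabla mu x y) z = - dotv (nabla mu x z) y.
Proof.
rewrite !dotv_nabla [mu x z]mu_anti [mu z y]mu_anti [mu y x]mu_anti.
have N u v : dotv (- u) v = - dotv (n := n) u v :> R.
  by rewrite /dotv -sumrN; apply: eq_bigr => i _; rewrite mxE mulNr.
by rewrite !N; field.
Qed.

Let rm x y z w : R := dotv (curvature mu x y z) w.

Lemma riemann_anti12 x y z w : rm x y z w = - rm y x z w.
Proof.
rewrite /rm /curvature [mu y x]mu_anti.
rewrite -[- mu x y]scaleN1r (linear_funZ _ _ (nabla_linear_l z)) /= scaleN1r opprK.
rewrite /dotv -sumrN; apply: eq_bigr => i _; rewrite !mxE; ring.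
Qed.

Lemma riemann_anti34 x y z w : rm x y z w = - rm x y w z.
Proof.
have D u v t : dotv (u + v) t = dotv (n := n) u t + dotv v t :> R.
  exact: (linear_funD _ _ (dotv_linear_l t)).
have N u v : dotv (- u) v = - dotv (n := n) u v :> R.
  by rewrite /dotv -sumrN; apply: eq_bigr => i _; rewrite mxE mulNr.
rewrite /rm /curvature !D !N.
rewrite (dotv_nabla_anti x _ w) (dotv_nabla_anti y _ w) (dotv_nabla_anti _ z w).
rewrite (dotv_nabla_anti x _ z) (dotv_nabla_anti y _ z).
rewrite ![dotv (nabla mu _ w) (nabla mu _ z)]dotvC; ring.
Qed.

Lemma riemann_bianchi x y z w : rm x y z w + rm y z x w + rm z x y w = 0.
Proof.
have -> : rm x y z w + rm y z x w + rm z x y w =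
   dotv (mu x (mu y z) + mu y (mu z x) + mu z (mu x y)) w; last first.
  by rewrite mu_jacobi /dotv big1 // => i _; rewrite mxE mul0r.
rewrite /rm /curvature.
have T a b c : nabla mu a (nabla mu b c) =
    nabla mu a (nabla mu c b) + nabla mu (mu b c) a + mu a (mu b c).
  rewrite [nabla mu b c]nabla_torsion (linear_funD _ _ (nabla_linear_r a)).
  by rewrite (nabla_torsion a (mu b c)) addrA.
rewrite [nabla mu x (nabla mu y z)]T [nabla mu y (nabla mu z x)]T [nabla mu z (nabla mu x y)]T.
rewrite /dotv -!big_split; apply: eq_bigr => i _ /=.
have aE (u v : 'rV[R]_n) : (u + v) 0 i = u 0 i + v 0 i by rewrite mxE.
have nE (u : 'rV[R]_n) : (- u) 0 i = - u 0 i by rewrite mxE.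
by rewrite -!mulrDl !(aE, nE); ring.
Qed.

(** The classical linear combination of four Bianchi identities, modulo the two antisymmetries. *)
Lemma riemann_pair x y z w : rm x y z w = rm z w x y.
Proof.
have b1 := riemann_bianchi x y z w; have b2 := riemann_bianchi y z w x.
have b3 := riemann_bianchi z w x y; have b4 := riemann_bianchi w x y z.
have a1 := riemann_anti34; have a2 := riemann_anti12.
move: (a2 z x y w) (a2 w y z x) (a2 x z w y) (a2 y w x z).
move: (a1 y z x w) (a1 z x y w) (a1 z w y x) (a1 w y z x) (a1 w x z y) (a1 x z w y).
move: (a1 x y w z) (a1 y w x z) (a2 y z w x) (a2 w x y z) (a2 z w x y) (a2 x y z w).
lra.
Qed.

(** The purpose of the curvature symmetries: tr (Ric^2) becomes a sum of squares, which can be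
    bounded entry by entry from both sides. *)
Lemma Ric_symm i j : Ric mu i j = Ric mu j i.
Proof.
rewrite !mxE; apply: eq_bigr => k _.
rewrite -/(rm _ _ _ _) -/(rm (basis_vec R k) (basis_vec R j) _ _).
by rewrite riemann_pair riemann_anti12 riemann_anti34 opprK.
Qed.

Lemma Ric_sqnormE : Ric_sqnorm mu = \sum_i \sum_j Ric mu i j ^+ 2.
Proof.
rewrite /Ric_sqnorm /mxtrace; apply: eq_bigr => i _; rewrite mxE.
by apply: eq_bigr => j _; rewrite (Ric_symm j i).
Qed.

End Curvature.

(** * Scalar curvature of solvable Lie algebras *)

(** q = B^T (B B^T)^-1 B for a matrix [B] whose rows are a basis. The Gram matrix is invertible
    because w B B^T = 0 forces |w B|^2 = 0. *)
Lemma orthogonal_projection (R : realType) (n : nat) (U : {vspace 'rV[R]_n}) :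
  exists q : 'M[R]_n, [/\ q^T = q, q *m q = q,
    forall x, x \in U -> x *m q = x & forall x : 'rV[R]_n, x *m q \in U].
Proof.
pose b i := (vbasis U)`_i.
pose B : 'M[R]_(\dim U, n) := \matrix_i b i.
have BU w : w *m B = \sum_(i < \dim U) w 0 i *: b i.
  by rewrite mulmx_sum_row; apply: eq_bigr => i _; rewrite rowK.
have Binj (w : 'rV_(\dim U)) : w *m B = 0 -> w = 0.
  rewrite BU => w0; apply/rowP => i; rewrite mxE.
  by have /freeP/(_ (fun i => w 0 i) w0 i) := basis_free (vbasisP U).
have Gu : B *m B^T \in unitmx.
  rewrite -row_free_unit -kermx_eq0; apply/eqP/row_matrixP => i; rewrite row0.
  apply: Binj; set w := row i _.
  have wG : w *m (B *m B^T) = 0 by rewrite -row_mul mulmx_ker row0.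
  have : \sum_j (w *m B) 0 j ^+ 2 = 0.
    have := congr1 (fun M => (M *m w^T) 0 0) wG.
    rewrite mul0mx [RHS]mxE -!mulmxA -trmx_mul mulmxA mxE => e; rewrite -[RHS]e.
    by apply: eq_bigr => j _; rewrite [_^T _ _]mxE expr2.
  move/eqP; rewrite psumr_eq0 => [/allP z|j _]; last exact: sqr_ge0.
  by apply/rowP => j; have := z j (mem_index_enum j); rewrite /= sqrf_eq0 => /eqP ->; rewrite mxE.
pose q := B^T *m invmx (B *m B^T) *m B.
have Bq : B *m q = B by rewrite /q !mulmxA mulmxV // mul1mx.
exists q; split.
- by rewrite /q !trmx_mul trmx_inv trmx_mul !trmxK mulmxA.
- by rewrite {1}/q -mulmxA Bq.
- move=> x /coord_vbasis xE.
  have -> : x = (\row_i coord (vbasis U) i x) *m B.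
    by rewrite BU {1}xE; apply: eq_bigr => i _; rewrite mxE.
  by rewrite -mulmxA Bq.
- move=> x; rewrite /q mulmxA BU; apply: memv_suml => i _; apply/memvZ/vbasis_mem.
  by apply: mem_nth; rewrite size_tuple.
Qed.

Definition mx_sqnorm (R : realType) (m n : nat) (A : 'M[R]_(m, n)) : R :=
  \sum_i \sum_j A i j ^+ 2.

Lemma mx_sqnorm_ge0 (R : realType) (m n : nat) (A : 'M[R]_(m, n)) :
  0 <= mx_sqnorm A.
Proof. by apply: sumr_ge0 => i _; apply: sumr_ge0 => j _; apply: sqr_ge0. Qed.

Lemma mx_sqnormE (R : realType) (m n : nat) (A : 'M[R]_(m, n)) :
  mx_sqnorm A = \tr (A *m A^T).
Proof.
by apply: eq_bigr => i _; rewrite mxE; apply: eq_bigr => j _; rewrite mxE.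
Qed.

Lemma mx_sqnorm_projection (R : realType) (m n : nat) (q : 'M[R]_m) (A : 'M[R]_(m, n)) :
  q^T = q -> q *m q = q ->
  mx_sqnorm ((1%:M - q) *m A) + mx_sqnorm (q *m A) = mx_sqnorm A.
Proof.
move=> qT qq; rewrite !mx_sqnormE !trmx_mul linearB /= trmx1 qT.
have E (p : 'M[R]_m) : p *m p = p -> \tr (p *m A *m (A^T *m p)) = \tr (A *m A^T *m p).
  by move=> pp; rewrite !mulmxA mxtrace_mulC !mulmxA pp -mulmxA mxtrace_mulC.
rewrite !E //; first by rewrite mulmxBr mulmx1 raddfB subrK.
by rewrite mulmxBl mul1mx mulmxBr mulmx1 qq subrr subr0.
Qed.

Section ScalarCurvatureBound.
Variables (R : realType) (n : nat) (mu : bracket R n).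
Hypotheses (mu_lie : is_lie_bracket mu) (mu_sol : lie_solvable mu).

(** For orthogonal projections [a] and [b], the squared norm of the bracket restricted to their
    images. *)
Let weighted (a b : 'M[R]_n) : R :=
  \sum_i mx_sqnorm (b *m ad mu (row i a)).

Lemma weightedE a b :
  weighted a b = \sum_i \sum_j \sum_k mu (row i a) (row j b) 0 k ^+ 2.
Proof.
apply: eq_bigr => i _; apply: eq_bigr => j _; apply: eq_bigr => k _.
by rewrite -(mulmx_ad mu_lie) -row_mul [in RHS]mxE.
Qed.

Lemma weightedC a b : weighted a b = weighted b a.
Proof.
rewrite !weightedE exchange_big; apply: eq_bigr => i _; apply: eq_bigr => j _.
by apply: eq_bigr => k _; rewrite (bracketC mu_lie) mxE sqrrN.
Qed.

Lemma weighted_split (q a : 'M[R]_n) : q^T = q -> q *m q = q ->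
  weighted a (1%:M - q) + weighted a q = weighted a 1%:M.
Proof.
move=> qT qq; rewrite -big_split; apply: eq_bigr => i _.
by rewrite /= mul1mx mx_sqnorm_projection.
Qed.

Lemma bracket_sqnormE : bracket_sqnorm mu = weighted 1%:M 1%:M.
Proof.
by rewrite weightedE; do 3![apply: eq_bigr => ? _]; rewrite /struct_const !rowE !mulmx1.
Qed.

Lemma killing_traceE :
  killing_trace mu = \sum_i \tr (ad mu (row i 1%:M) *m ad mu (row i 1%:M)).
Proof.
apply: eq_bigr => i _; apply: eq_bigr => j _; rewrite mxE; apply: eq_bigr => k _.
by rewrite /struct_const rowE mulmx1 !mxE.
Qed.

Lemma killing_derived_space x y :
  x \in derived_space mu fullv -> \tr (ad mu x *m ad mu y) = 0.
Proof.
rewrite /derived_space; set s := [seq _ | _ <- _, _ <- _] => xs.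
have adZ : linear (ad mu) := fun a x y => ad_linear mu_lie a x y.
have -> : x = \sum_(i < size s) coord (in_tuple s) i x *: s`_i.
  exact: (coord_span (X := in_tuple s)).
rewrite (linear_fun_sum _ _ _ adZ) mulmx_suml raddf_sum big1 // => i _.
have /allpairsP[[u v] [_ _ ->]] : s`_i \in s by apply: mem_nth.
by rewrite -scalemxAl /= mxtraceZ (killing_derived mu_lie mu_sol) mulr0.
Qed.

(* With [p + q = 1] the orthogonal projections onto the complement of
   [[s, s]] and onto [[s, s]], and [S] the symmetric part,
   [- Scal >= 1/2 sum |S (ad p_i)|^2 + 1/2 sum |S (q (ad p_i) q)|^2
     + 1/4 sum |[q_i, q_j]|^2]. *)
Lemma bracket_sqnorm_le_Scal (c : R) : 0 <= c ->
  (forall x, - \tr (ad mu x *m ad mu x) <= c * sym_sqnorm (ad mu x)) ->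
  bracket_sqnorm mu <= (12 + 4 * c) * - Scal mu.
Proof.
move=> c0 bound.
have [q [qT qq qid qim]] := orthogonal_projection (derived_space mu fullv).
pose p := 1%:M - q : 'M[R]_n.
have pT : p^T = p by rewrite /p linearB /= trmx1 qT.
have pp : p *m p = p by rewrite /p mulmxBl mul1mx mulmxBr mulmx1 qq subrr subr0.
have adq x : ad mu x *m q = ad mu x.
  apply/row_matrixP => i; rewrite row_mul rowE (mulmx_ad mu_lie) qid //.
  by apply: (mem_derived_space mu_lie); apply: memvf.
have adZ : linear (ad mu) := fun a x y => ad_linear mu_lie a x y.
have KE : killing_trace mu = \sum_i \tr (ad mu (row i p) *m ad mu (row i p)).
  rewrite killing_traceE; apply: eq_bigr => i _.
  have -> : row i 1%:M = row i p + row i q :> 'rV[R]_n.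
    by rewrite -linearD /= /p subrK.
  rewrite (linear_funD _ _ adZ) mulmxDl !mulmxDr !mxtraceD.
  have z x : \tr (ad mu (row i q) *m ad mu x) = 0.
    by apply: killing_derived_space; rewrite rowE qim.
  by rewrite [\tr (ad mu (row i p) *m ad mu (row i q))]mxtrace_mulC !z !addr0.
set K := killing_trace mu in KE.
pose Pp := weighted p p; pose M := weighted p q; pose Q := weighted q q.
have T_ge0 a b : 0 <= weighted a b by apply: sumr_ge0 => i _; apply: mx_sqnorm_ge0.
have TE : bracket_sqnorm mu = Pp + M + (M + Q).
  rewrite bracket_sqnormE -(weighted_split _ qT qq) ![weighted 1%:M _]weightedC.
  by rewrite -!(weighted_split _ qT qq) -/p (weightedC q p).
(* All brackets lie in the image of [q], so multiplying [ad] by [q] on the left compresses it to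
   [s, s] without changing the trace of its square. *)
have KM : 0 <= K + M.
  have -> : K + M = \sum_i sym_sqnorm (q *m ad mu (row i p)) * 2.
    rewrite KE -big_split; apply: eq_bigr => i _ /=.
    rewrite sym_sqnormE divfK ?pnatr_eq0 // mx_sqnormE; congr (_ + _).
    set A := ad mu (row i p).
    have -> : q *m A *m (q *m A) = q *m (A *m A).
      by rewrite mulmxA -[q *m A *m q]mulmxA adq mulmxA.
    by rewrite [RHS]mxtrace_mulC -mulmxA adq.
  by apply: sumr_ge0 => i _; rewrite mulr_ge0 // sym_sqnorm_ge0.
pose u := \sum_i sym_sqnorm (ad mu (row i p)).
have uE : u = (K + (Pp + M)) / 2.
  rewrite KE /Pp /M (weighted_split _ qT qq) -big_split mulr_suml.
  by apply: eq_bigr => i _ /=; rewrite sym_sqnormE mul1mx mx_sqnormE.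
have u_ge0 : 0 <= u by apply: sumr_ge0 => i _; apply: sym_sqnorm_ge0.
have Ku : - K <= c * u.
  by rewrite KE -sumrN mulr_sumr; apply: ler_sum => i _; apply: bound.
have SE := ScalE (lie_linear_l mu_lie) (lie_linear_r mu_lie) (lie_alternating mu_lie).
have H_ge0 : 0 <= \sum_i mean_curv mu i ^+ 2 by apply: sumr_ge0 => i _; apply: sqr_ge0.
(* 2 (- Scal) - u = 2 |H|^2 + (K + M)/2 + Q/2 >= 0. Then - K <= c u <= 2 c (- Scal) is inserted into
   |mu|^2 = 4 (- Scal) - 4 |H|^2 - 2 K; the 12 is generous. *)
have cu : c * u <= c * (2 * - Scal mu).
  by apply: ler_wpM2l => //; rewrite SE TE -/K; have := T_ge0 q q; rewrite -/Q; lra.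
have := T_ge0 p p; have := T_ge0 q q; have := T_ge0 p q; rewrite -/Pp -/M -/Q.
have : (12 + 4 * c) * - Scal mu = 12 * - Scal mu + 2 * (c * (2 * - Scal mu)) by ring.
move=> ->; move: cu; set cs := c * (2 * _); rewrite SE TE -/K; lra.
Qed.

End ScalarCurvatureBound.

(** * Lower bound for F along a GL-orbit *)

Lemma gl_act_ad (R : realType) (n : nat) (mu : bracket R n) (h : 'M[R]_n) x :
  is_lie_bracket mu -> is_lie_bracket (gl_act h mu) ->
  ad (gl_act h mu) x = invmx h *m ad mu (x *m invmx h) *m h.
Proof.
move=> lie lie'; apply/row_matrixP => i.
by rewrite !rowE (mulmx_ad lie') !mulmxA (mulmx_ad lie).
Qed.

Lemma real_type_orbit_bound (R : realType) (n : nat) (mu : bracket R n) :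
  is_lie_bracket mu -> lie_solvable mu -> real_type mu ->
  exists2 c, 0 < c & forall nu, gl_orbit mu nu -> is_lie_bracket nu -> lie_solvable nu ->
    bracket_sqnorm nu <= c * - Scal nu.
Proof.
move=> lie sol real.
have [c c0 cP] := real_type_killing_bound lie sol real.
exists (12 + 4 * c) => [|_ [h /= hu <-] lie' sol']; first by lra.
apply: bracket_sqnorm_le_Scal => // x.
by apply: cP (gl_act_ad x lie lie'); rewrite mulVmx.
Qed.

(** Ric has 7^2 entries, each at most 6 * 7^2 |nu|^2, so |Ric| <= k |nu|^2 <= k c (- Scal) with k =
    7 * (6 * 7^2). *)
Lemma F_lower_bound (R : realType) (c : R) (nu : bracket R 7) :
  0 < c -> is_lie_bracket nu -> bracket_sqnorm nu <= c * - Scal nu ->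
  0 < bracket_sqnorm nu -> (c ^+ 2 * (7 * (6 * 7 ^+ 2)) ^+ 2)^-1 <= F nu.
Proof.
move=> c0 lie le T0.
have Rs : Ric_sqnorm nu = \sum_i \sum_j Ric nu i j ^+ 2.
  by apply: Ric_sqnormE; case: lie.
have Rle : Ric_sqnorm nu <= (7 * (6 * 7 ^+ 2)) ^+ 2 * bracket_sqnorm nu ^+ 2.
  have -> : (7 * (6 * 7 ^+ 2)) ^+ 2 * bracket_sqnorm nu ^+ 2 =
    \sum_(i < 7) \sum_(j < 7) (6 * 7%:R ^+ 2 * bracket_sqnorm nu) ^+ 2.
    by rewrite !sumr_const card_ord -mulrnA -[RHS]mulr_natl natrM; ring.
  rewrite Rs; apply: ler_sum => i _; apply: ler_sum => j _.
  by apply: Ric_sqr_le; case: lie.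
have S0 : 0 < - Scal nu by rewrite -(pmulr_rgt0 _ c0); apply: lt_le_trans le.
(* Division by 0 would give [F nu] = 0; this is excluded because Ric has nonzero trace. *)
have Rgt0 : 0 < Ric_sqnorm nu.
  rewrite lt0r; apply/andP; split; last first.
    by rewrite Rs; apply: sumr_ge0 => i _; apply: sumr_ge0 => j _; apply: sqr_ge0.
  apply: contraTneq S0 => R0; suff -> : Scal nu = 0 by rewrite oppr0 ltxx.
  apply: big1 => i _; apply/eqP; rewrite -sqrf_eq0.
  move/eqP: R0; rewrite Rs psumr_eq0 => [/allP/(_ i (mem_index_enum i)) /=|j _]; last first.
    by apply: sumr_ge0 => k _; apply: sqr_ge0.
  rewrite psumr_eq0 => [/allP/(_ i (mem_index_enum i)) //|j _]; exact: sqr_ge0.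
rewrite /F ler_pdivlMr //.
set k := 7 * _ in Rle *.
have k0 : 0 < k by rewrite /k; lra.
rewrite mulrC ler_pdivrMr ?mulr_gt0 ?exprn_gt0 //.
apply: (le_trans Rle); apply: le_trans (_ : k ^+ 2 * (c * - Scal nu) ^+ 2 <= _).
  by rewrite ler_wpM2l ?sqr_ge0 // ler_pXn2r // nnegrE ltW // mulr_gt0.
by rewrite le_eqVlt; apply/orP; left; apply/eqP; ring.
Qed.

(** * Almost abelian Lie algebras *)

Section AlmostAbelian.
Variables (R : realType) (n : nat) (D : 'M[R]_n.+1).
Hypothesis D_max : col ord_max D = 0.

(** The hyperplane [x 0 ord_max = 0] is an abelian ideal, on which the last basis vector acts by
    [D]. *)
Definition almost_abelian : bracket R n.+1 := fun x y =>
  x 0 ord_max *: (y *m D) - y 0 ord_max *: (x *m D).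

Lemma almost_abelian_max x y : almost_abelian x y 0 ord_max = 0.
Proof.
have z u : (u *m D) 0 ord_max = 0 :> R.
  rewrite mxE big1 // => i _.
  by have /colP/(_ i) := D_max; rewrite !mxE => ->; rewrite mulr0.
have aE (u v : 'rV[R]_n.+1) : (u - v) 0 ord_max = u 0 ord_max - v 0 ord_max by rewrite !mxE.
have sE a (v : 'rV[R]_n.+1) : (a *: v) 0 ord_max = a * v 0 ord_max by rewrite mxE.
by rewrite /almost_abelian aE !sE !z !mulr0 subrr.
Qed.

Lemma almost_abelian_lie : is_lie_bracket almost_abelian.
Proof.
have L x : linear (almost_abelian x).
  move=> a u v; rewrite /almost_abelian mulmxDl -scalemxAl.
  by apply/rowP => k; rewrite ![_ (_ + _) _ _]mxE !(mxE, mulmx_sum_row); ring.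
have anti x y : almost_abelian x y = - almost_abelian y x.
  by rewrite /almost_abelian opprB.
have act (x y : 'rV[R]_n.+1) : y 0 ord_max = 0 -> almost_abelian x y = x 0 ord_max *: (y *m D).
  by move=> y0; rewrite /almost_abelian y0 scale0r subr0.
split=> //.
- by move=> y a u v; rewrite ![almost_abelian _ y]anti L opprD scalerN.
- by move=> x; rewrite /almost_abelian subrr.
move=> x y z; rewrite !(act _ (almost_abelian _ _)) ?almost_abelian_max //.
rewrite /almost_abelian !mulmxBl -!scalemxAl !scalerBr !scalerA.
rewrite [y 0 _ * x 0 _]mulrC [z 0 _ * x 0 _]mulrC [z 0 _ * y 0 _]mulrC.
by apply/rowP => k; rewrite !mxE; ring.
Qed.

Lemma almost_abelian_solvable : lie_solvable almost_abelian.
Proof.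
pose U := derived_space almost_abelian fullv; exists 2.
have U0 (x : 'rV[R]_n.+1) : x \in U -> x 0 ord_max = 0.
  move=> xU; have /coord_span -> := xU : x \in span (in_tuple _).
  rewrite summxE big1 // => i _; rewrite mxE.
  have /allpairsP[[u v] [_ _ ->]] := mem_nth 0 (ltn_ord i).
  by rewrite almost_abelian_max mulr0.
apply/eqP; rewrite -subv0 /= -/U; apply/subvP => w wU.
have /coord_span -> := wU : w \in span (in_tuple _).
rewrite memv0 big1 // => i _.
have /allpairsP[[x y] /= [/vbasis_mem/U0 x0 /vbasis_mem/U0 y0 ->]] := mem_nth 0 (ltn_ord i).
by rewrite /almost_abelian x0 y0 !scale0r subrr scaler0.
Qed.

(** One nonzero real eigenvalue of [D] on the ideal is enough: off the ideal it gives [ad x] a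
    nonzero real eigenvalue, and on the ideal [ad x] has square 0. *)
Lemma almost_abelian_real (v : 'rV[R]_n.+1) (a : R) :
  v != 0 -> v 0 ord_max = 0 -> v *m D = a *: v -> a != 0 -> real_type almost_abelian.
Proof.
move=> vN0 v0 vD aN0 x; have lie := almost_abelian_lie.
have act (u y : 'rV[R]_n.+1) : y 0 ord_max = 0 -> almost_abelian u y = u 0 ord_max *: (y *m D).
  by move=> y0; rewrite /almost_abelian y0 scale0r subr0.
have [x0|xN0] := eqVneq (x 0 ord_max) 0.
  left; exists 2; rewrite expr2; apply/row_matrixP => i.
  rewrite row0 -[_ * _]/(_ *m _) row_mul rowE !(mulmx_ad lie).
  by rewrite act ?almost_abelian_max // x0 scale0r.
right=> sub.
have /sub : spec (ad almost_abelian x) (real_complex R (x 0 ord_max * a)).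
  apply/eigenvalueP; exists (map_mx (real_complex R) v); last first.
    apply: contra vN0 => /eqP e; apply/eqP/rowP => i.
    by have /rowP/(_ i) := e; rewrite !mxE => -[].
  by rewrite -map_mxM (mulmx_ad lie) act // vD scalerA map_mxZ.
by rewrite /imaginary_axis /= => /eqP; rewrite mulf_eq0 (negPf xN0) (negPf aN0).
Qed.

Lemma almost_abelian_struct i j k : struct_const almost_abelian i j k =
  (i == ord_max)%:R * D j k - (j == ord_max)%:R * D i k.
Proof.
rewrite /struct_const /almost_abelian.
have aE (u v : 'rV[R]_n.+1) : (u - v) 0 k = u 0 k - v 0 k by rewrite !mxE.
have sE a (v : 'rV[R]_n.+1) : (a *: v) 0 k = a * v 0 k by rewrite mxE.
by rewrite aE !sE -!rowE !mxE !eqxx !(eq_sym ord_max).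
Qed.

End AlmostAbelian.

(** * A family of brackets with small F *)

Lemma det3E (R : comNzRingType) (A : 'M[R]_3) :
  let a i j := A (inord i) (inord j) in
  \det A = a 0%N 0%N * (a 1%N 1%N * a 2%N 2%N - a 1%N 2%N * a 2%N 1%N)
         - a 0%N 1%N * (a 1%N 0%N * a 2%N 2%N - a 1%N 2%N * a 2%N 0%N)
         + a 0%N 2%N * (a 1%N 0%N * a 2%N 1%N - a 1%N 1%N * a 2%N 0%N).
Proof.
move=> a; have aE (i j : 'I_3) : A i j = a i j by rewrite /a !inord_val.
rewrite (expand_det_row _ ord0) !big_ord_recl big_ord0 /cofactor.
rewrite !(expand_det_row _ ord0) !big_ord_recl !big_ord0 /cofactor !det_mx11.
rewrite !mxE !aE /= /bump /= !expr0 !addn0 ?expr1; ring.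
Qed.

Lemma det4E (R : comNzRingType) (A : 'M[R]_4) :
  let a i j := A (inord i) (inord j) in
  let m i j k := a 1%N i * (a 2%N j * a 3%N k - a 2%N k * a 3%N j)
               - a 1%N j * (a 2%N i * a 3%N k - a 2%N k * a 3%N i)
               + a 1%N k * (a 2%N i * a 3%N j - a 2%N j * a 3%N i) in
  \det A = a 0%N 0%N * m 1%N 2%N 3%N - a 0%N 1%N * m 0%N 2%N 3%N
         + a 0%N 2%N * m 0%N 1%N 3%N - a 0%N 3%N * m 0%N 1%N 2%N.
Proof.
move=> a m; have aE (i j : 'I_4) : A i j = a i j by rewrite /a !inord_val.
rewrite (expand_det_row _ ord0) !big_ord_recl big_ord0 /cofactor.
by rewrite /m !det3E !mxE !aE /= /bump /= !inordK //= !(add0n, add1n); ring.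
Qed.

(* [e_7] acts on [R^6 = C^3], with complex coordinates [e_1 + i e_2],
   [e_3 + i e_4], [e_5 + i e_6], by
   [[i + t, t, 0], [t, - i + t, 0], [0, 0, - 2 t]], the sum of a
   skew-hermitian and of [t] times a hermitian matrix that do not commute. *)
Definition example_coef (R : realType) (t : R) (i j : nat) : R :=
  nth 0 (nth [::] [:: [:: t; 1; t; 0; 0; 0; 0]; [:: -1; t; 0; t; 0; 0; 0];
                      [:: t; 0; t; -1; 0; 0; 0]; [:: 0; t; 1; t; 0; 0; 0];
                      [:: 0; 0; 0; 0; - t - t; 0; 0]; [:: 0; 0; 0; 0; 0; - t - t; 0]] i) j.

(** The list has no row of index 6; the default of [nth] makes the image of e_7 zero. *)
Definition example_mx (R : realType) (t : R) : 'M[R]_7 :=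
  \matrix_(i, j) example_coef t i j.

Definition example (R : realType) (t : R) : bracket R 7 :=
  almost_abelian (example_mx t).

(** Summands are indexed by [nat], so that every index is a literal and coefficients compute. *)
Definition sum7 (R : realType) (f : nat -> R) : R :=
  f 0%N + f 1%N + f 2%N + f 3%N + f 4%N + f 5%N + f 6%N.

Lemma sum7E (R : realType) (f : nat -> R) : \sum_(i < 7) f i = sum7 f.
Proof. by rewrite !big_ord_recl big_ord0 /= /bump /= !(add0n, add1n) /sum7; ring. Qed.

Lemma example_col (R : realType) (t : R) : col ord_max (example_mx t) = 0.
Proof.
by apply/colP => -[i i7]; rewrite !mxE /=; do 7?[case: i i7 => [|i] i7 //].
Qed.

Definition example_struct (R : realType) (t : R) (i j k : nat) : R :=
  if i == 6%N then (if j == 6%N then 0 else example_coef t j k)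
  else if j == 6%N then - example_coef t i k else 0.

Lemma example_structE (R : realType) (t : R) i j k :
  struct_const (example t) i j k = example_struct t i j k.
Proof.
rewrite /example almost_abelian_struct /example_struct !mxE -!(inj_eq val_inj) /=.
case: eqP => [->|_]; case: eqP => [->|_]; rewrite /= ?mul1r ?mul0r ?subrr ?subr0 ?sub0r //.
Qed.

Definition example_christoffel (R : realType) (t : R) (i j k : nat) : R :=
  (example_struct t i j k - example_struct t j k i + example_struct t k i j) / 2.

Lemma example_christoffelE (R : realType) (t : R) i j k :
  christoffel (example t) i j k = example_christoffel t i j k.
Proof. by rewrite /christoffel !example_structE. Qed.

(** The rotation contributes - 4 to the Killing trace and 8 to the squared norm; these cancel in
    Scal and only multiples of t^2 remain. *)
Lemma example_Scal (R : realType) (t : R) : Scal (example t) = - 16 * t ^+ 2.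
Proof.
have lie := almost_abelian_lie (example_col t).
rewrite ScalE; [|by case: lie..].
have -> : \sum_i mean_curv (example t) i ^+ 2 = 0.
  transitivity (sum7 (fun i => (sum7 (fun k => example_struct t i k k)) ^+ 2)).
    rewrite -sum7E; apply: eq_bigr => i _; rewrite -sum7E; congr (_ ^+ 2).
    by apply: eq_bigr => k _; rewrite example_structE.
  by rewrite /sum7 /example_struct /example_coef /=; ring.
have -> : killing_trace (example t) = 16 * t ^+ 2 - 4.
  transitivity (sum7 (fun i => sum7 (fun j => sum7 (fun k =>
      example_struct t i j k * example_struct t i k j)))).
    rewrite -sum7E; apply: eq_bigr => i _; rewrite -sum7E; apply: eq_bigr => j _.
    by rewrite -sum7E; apply: eq_bigr => k _; rewrite !example_structE.
  by rewrite /sum7 /example_struct /example_coef /=; ring.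
have -> : bracket_sqnorm (example t) = 32 * t ^+ 2 + 8.
  transitivity (sum7 (fun i => sum7 (fun j => sum7 (fun k =>
      example_struct t i j k ^+ 2)))).
    rewrite -sum7E; apply: eq_bigr => i _; rewrite -sum7E; apply: eq_bigr => j _.
    by rewrite -sum7E; apply: eq_bigr => k _; rewrite !example_structE.
  by rewrite /sum7 /example_struct /example_coef /=; ring.
by field.
Qed.

(** This entry, for e_1 and e_4, is up to sign t times the entry 2 of the commutator of the skew and
    symmetric parts; squaring removes the sign. *)
Lemma example_Ric (R : realType) (t : R) :
  Ric (example t) (inord 0) (inord 3) ^+ 2 = 4 * t ^+ 2.
Proof.
have lie := almost_abelian_lie (example_col t).
pose G := example_christoffel t; pose c := example_struct t.
rewrite RicE; [|by case: lie..].
transitivity ((sum7 (fun k => sum7 (fun m =>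
   G 0%N 3 m * G k m k - G k 3 m * G 0%N m k - c k 0%N m * G m 3 k))) ^+ 2).
  congr (_ ^+ 2); rewrite -sum7E; apply: eq_bigr => k _.
  rewrite -sum7E; apply: eq_bigr => m _.
  by rewrite !example_christoffelE !example_structE !inordK.
rewrite /sum7 /G /c /example_christoffel /example_struct /example_coef /=.
by field.
Qed.

(** * Closedness of the examples *)

Definition minor3 (R : realType) (u v w : nat -> R) (i j k : nat) : R :=
  u i * (v j * w k - v k * w j) - u j * (v i * w k - v k * w i)
  + u k * (v i * w j - v j * w i).

Definition phi_coord (R : realType) (u v w : nat -> R) : R :=
  let e := minor3 u v w in
  e 0%N 1%N 6%N + e 2%N 3%N 6%N + e 4%N 5%N 6%N + e 0%N 2%N 4%N
  - e 0%N 3%N 5%N - e 1%N 2%N 5%N - e 1%N 3%N 4%N.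

Definition entry (R : realType) (n : nat) (x : 'rV[R]_n.+1) (k : nat) : R := x 0 (inord k).

Lemma phiE (R : realType) (X : 'M[R]_(3, 7)) :
  phi X = phi_coord (entry (row (inord 0) X)) (entry (row (inord 1) X)) (entry (row (inord 2) X)).
Proof.
have E i j k : e3 i j k X = minor3 (entry (row (inord 0) X)) (entry (row (inord 1) X))
   (entry (row (inord 2) X)) i.-1 j.-1 k.-1.
  rewrite /e3 /coframe det3E !mxE !(tnth_nth ord0) /= !inordK //=.
  by rewrite /minor3 /entry !mxE; ring.
by rewrite /phi !E /phi_coord.
Qed.

Lemma example_coord (R : realType) (t : R) (x y : 'rV[R]_7) k : (k < 7)%N ->
  entry (example t x y) k =
  sum7 (fun i => (entry x 6 * entry y i - entry y 6 * entry x i) * example_coef t i k).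
Proof.
move=> k7; rewrite /entry /example /almost_abelian.
have aE (u v : 'rV[R]_7) l : (u - v) 0 l = u 0 l - v 0 l by rewrite !mxE.
have sE a (v : 'rV[R]_7) l : (a *: v) 0 l = a * v 0 l by rewrite mxE.
have -> : ord_max = inord 6 :> 'I_7 by apply/val_inj; rewrite /= inordK.
rewrite aE !sE !mxE !mulr_sumr -sumrB -sum7E; apply: eq_bigr => i _.
by rewrite !mxE inordK // inord_val; ring.
Qed.

Lemma row_row' (R : realType) (m n : nat) (i : 'I_m.+1) (j : 'I_m) (X : 'M[R]_(m.+1, n)) :
  row j (row' i X) = row (lift i j) X.
Proof. by apply/rowP => k; rewrite !mxE. Qed.

Lemma phi_col_mx (R : realType) (u : 'rV[R]_7) (Y : 'M[R]_(2, 7)) :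
  phi (col_mx u Y : 'M_(1 + 2, 7)) =
  phi_coord (entry u) (entry (row (inord 0) Y)) (entry (row (inord 1) Y)).
Proof.
have r0 : row (inord 0) (col_mx u Y : 'M_(3, 7)) = u.
  by apply/rowP => k; rewrite !mxE; case: splitP => i; rewrite inordK // ?ord1.
have rS a : (a < 2)%N -> row (inord a.+1) (col_mx u Y : 'M_(3, 7)) = row (inord a) Y.
  move=> a2; apply/rowP => k; rewrite !mxE.
  case: splitP => i; rewrite inordK //; first by rewrite ord1.
  by rewrite add1n => -[e]; congr (Y _ _); apply/ord_inj; rewrite -e inordK.
by rewrite phiE r0 !rS.
Qed.

Definition example_act (R : realType) (t : R) (x : nat -> R) (k : nat) : R :=
  sum7 (fun i => x i * example_coef t i k).

Lemma phi_coord_example (R : realType) (t : R) (x y : 'rV[R]_7) (v w : nat -> R) :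
  phi_coord (entry (example t x y)) v w =
  entry x 6 * phi_coord (example_act t (entry y)) v w
  - entry y 6 * phi_coord (example_act t (entry x)) v w.
Proof.
have E k : (k < 7)%N -> entry (example t x y) k =
    entry x 6 * example_act t (entry y) k - entry y 6 * example_act t (entry x) k.
  by move=> k7; rewrite example_coord // /example_act /sum7; ring.
by rewrite /phi_coord /minor3 !E //; ring.
Qed.

(** The Kaehler form e^12 + e^34 + e^56 of C^3: [phi] is omega /\ e^7 plus the real part of the
    complex volume form. *)
Definition omega (R : realType) (u v : nat -> R) : R :=
  u 0%N * v 1%N - u 1%N * v 0%N + (u 2%N * v 3%N - u 3%N * v 2%N)
  + (u 4%N * v 5%N - u 5%N * v 4%N).

Definition example_domega (R : realType) (t : R) (u v : nat -> R) : R :=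
  omega (example_act t u) v + omega u (example_act t v).

(* The action preserves the real part of the complex volume form, hence only
   the part [omega /\ e^7] of [phi] contributes. *)
Lemma phi_coord_act (R : realType) (t : R) (u v w : nat -> R) :
  phi_coord (example_act t u) v w - phi_coord (example_act t v) u w
    + phi_coord (example_act t w) u v =
  example_domega t u v * w 6 - example_domega t u w * v 6
    + example_domega t v w * u 6.
Proof.
rewrite /example_domega /omega /phi_coord /minor3 /example_act /sum7 /example_coef /=.
ring.
Qed.

Lemma example_closed (R : realType) (t : R) (X : 'M[R]_(4, 7)) :
  ce_diff (example t) (@phi R) X = 0.
Proof.
have lE m (i : 'I_m.+1) (j : 'I_m) : lift i j = inord (bump i j) :> 'I_m.+1.
  by apply/val_inj; rewrite [RHS]inordK //; exact: ltn_ord (lift i j).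
have oE m : ord0 = inord 0 :> 'I_m.+1 by apply/val_inj; rewrite /= inordK.
rewrite /ce_diff.
under eq_bigr do rewrite big_mkcond.
rewrite !big_ord_recl !big_ord0 /= !phi_col_mx !row_row' !lE !oE /= !inordK //=.
rewrite /bump /= !(add0n, add1n, addn0) /=.
rewrite !phi_coord_example.
set x := entry (row (inord 0) X); set y := entry (row (inord 1) X).
set z := entry (row (inord 2) X); set w := entry (row (inord 3) X).
clearbody x y z w.
pose d u v w' := phi_coord (example_act t u) v w' - phi_coord (example_act t v) u w'
    + phi_coord (example_act t w') u v.
(* The terms are grouped by the argument whose e_7 coordinate multiplies them. By [phi_coord_act]
   each [d] contains another e_7 coordinate, and all cancel as in e^7 /\ e^7 = 0. *)
transitivity (- (x 6 * d y z w) + y 6 * d x z w - z 6 * d x y w + w 6 * d x y z).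
  by rewrite /d; ring.
have dE u v w' : d u v w' = _ := phi_coord_act t u v w'.
by rewrite !dE; ring.
Qed.

(** * Torsion of the examples *)

Lemma det_row_eq0 (R : comNzRingType) (n : nat) (A : 'M[R]_n) (i : 'I_n) :
  row i A = 0 -> \det A = 0.
Proof.
move=> /rowP Ai; rewrite (expand_det_row _ i) big1 // => j _.
by have := Ai j; rewrite !mxE => ->; rewrite mul0r.
Qed.

Lemma star_phi_row0 (R : realType) (Y : 'M[R]_(3, 7)) :
  star_phi (col_mx 0 Y : 'M_(1 + 3, 7)) = 0.
Proof.
rewrite /star_phi /hodge_star big1 ?mulr0 // => I _.
rewrite [\det _](@det_row_eq0 _ _ _ (rshift 3 (lshift 3 (0 : 'I_1)))) ?mulr0 //.
by apply/rowP => k; rewrite [LHS]mxE (col_mxEd (rowsub I 1%:M) (col_mx 0 Y : 'M_(1 + 3, 7))) col_mxEu !mxE.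
Qed.

(** Only the invertibility of the block swap is wanted from this, so the sign of its determinant is
    never computed. *)
Lemma det_swap_blocks (R : fieldType) (m n : nat) (W := block_mx 0 1%:M 1%:M 0 : 'M[R]_(n + m, m + n)) :
  W *m (block_mx 0 1%:M 1%:M 0 : 'M_(m + n, n + m)) = 1%:M.
Proof.
by rewrite mulmx_block !mulmx0 !mul0mx !mulmx1 addr0 !add0r addr0 -scalar_mx_block.
Qed.

(** If some row has no e_5, e_6, e_7 part, both sides vanish; otherwise all rows lie in the span of
    e_5, e_6, e_7, where [phi] is e^567, the determinant. *)
Lemma phi_mul_minor (R : realType) (P : 'M[R]_(3, 4 + 3)) :
  (forall i, (forall b, P i (rshift 4 b) = 0) \/ (forall a, P i (lshift 3 a) = 0)) ->
  phi (P : 'M_(3, 7)) * \det (rsubmx P) = \det (rsubmx P) ^+ 2.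
Proof.
move=> H; pose p a k := entry (row (inord a) (P : 'M_(3, 7))) k.
have rE a b : (b < 3)%N -> rsubmx P (inord a) (inord b) = p a (4 + b)%N.
  move=> b3; rewrite /p /entry !mxE; congr (P _ _); apply/ord_inj.
  by rewrite /= !inordK // ltn_add2l.
have {}H a : (p a 4 = 0 /\ p a 5 = 0 /\ p a 6 = 0) \/
   (p a 0%N = 0 /\ p a 1%N = 0 /\ p a 2 = 0 /\ p a 3 = 0).
  case: (H (inord a)) => z; [left|right].
    have q b : (b < 3)%N -> p a (4 + b)%N = 0 by move=> b3; rewrite -rE // mxE.
    by split; [exact: (q 0%N)|split; [exact: (q 1%N)|exact: (q 2)]].
  have q b : (b < 4)%N -> p a b = 0.
    move=> b4; rewrite -(z (inord b)) /p /entry mxE; congr (P _ _); apply/ord_inj.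
    by rewrite /= !inordK // (leq_trans b4).
  by do !split; apply: q.
rewrite phiE det3E !rE // -!/(p _) /phi_coord /minor3.
have p0 k : entry (row (inord 0) (P : 'M_(3, 7))) k = p 0%N k by [].
have p1 k : entry (row (inord 1) (P : 'M_(3, 7))) k = p 1%N k by [].
have p2 k : entry (row (inord 2) (P : 'M_(3, 7))) k = p 2 k by [].
rewrite !p0 !p1 !p2 !(add0n, addn0) -[(4 + 1)%N]/5%N -[(4 + 2)%N]/6%N.
case: (H 0%N) => [[-> [-> ->]]|[-> [-> [-> ->]]]]; first by ring.
case: (H 1%N) => [[-> [-> ->]]|[-> [-> [-> ->]]]]; first by ring.
by case: (H 2) => [[-> [-> ->]]|[-> [-> [-> ->]]]]; ring.
Qed.

(* [*phi] restricted to the span of [e_1, ..., e_4] is a nonzero multiple of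
   the determinant (in fact equal to it). *)
Lemma star_phi_e1234 (R : realType) : exists2 k : R, k != 0 &
  forall Y : 'M[R]_(4, 4 + 3), rsubmx Y = 0 ->
    star_phi (Y : 'M_(4, 7)) = k * \det (lsubmx Y).
Proof.
pose W : 'M[R]_(4 + 3, 3 + 4) := block_mx 0 1%:M 1%:M 0.
pose dW : R := \det (W : 'M_7).
have dW0 : dW != 0.
  have := congr1 (fun M : 'M[R]_7 => \det M) (det_swap_blocks R 3 4).
  rewrite /= det1 => e; apply/eqP => d0; have := oner_neq0 R.
  by rewrite -e (det_mulmx (W : 'M_7)) -/dW d0 mul0r eqxx.
pose P (I : {ffun 'I_3 -> 'I_(3 + 4)}) : 'M[R]_(3, 4 + 3) := rowsub I 1%:M.
have detE I (Y : 'M[R]_(4, 4 + 3)) : rsubmx Y = 0 ->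
    \det (col_mx (P I) Y : 'M_7) = \det (rsubmx (P I)) * \det (lsubmx Y) / dW.
  move=> Y0; apply: (mulIf dW0); rewrite divfK // /dW -det_mulmx.
  have -> : (col_mx (P I) Y : 'M_7) *m (W : 'M_7) =
      block_mx (rsubmx (P I)) (lsubmx (P I)) 0 (lsubmx Y) :> 'M_(3 + 4).
    rewrite -[P I in LHS]hsubmxK -[Y in LHS]hsubmxK Y0.
    rewrite [LHS](@mulmx_block _ 3 4 4 3 3 4 (lsubmx (P I)) (rsubmx (P I)) (lsubmx Y) 0 0 1%:M 1%:M 0).
    by rewrite !mulmx0 !mulmx1 !addr0 !add0r.
  exact: (det_ublock (rsubmx (P I)) (lsubmx (P I)) (lsubmx Y)).
(* A sum of squares, nonzero because the multi-index of e_5, e_6, e_7 contributes 1. *)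
pose s := \sum_I \det (rsubmx (P I)) ^+ 2.
have s0 : s != 0.
  pose J : {ffun 'I_3 -> 'I_(3 + 4)} := [ffun b => rshift 4 b].
  have PJ : rsubmx (P J) = 1%:M.
    by apply/matrixP => i j; rewrite !mxE ffunE -!(inj_eq val_inj) /= eqn_add2l.
  rewrite /s (bigD1 J) //= PJ det1 expr1n gt_eqF // ltr_pwDl ?ltr01 //.
  by apply: sumr_ge0 => I _; apply: sqr_ge0.
exists ((3`!%:R)^-1 * s / dW).
  by rewrite !mulf_neq0 ?invr_eq0 // pnatr_eq0.
move=> Y Y0; rewrite /star_phi /hodge_star -!mulrA; congr (_ * _).
rewrite /s mulr_suml; apply: eq_bigr => I _.
rewrite -[rowsub I 1%:M]/(P I) [\det _](detE I Y Y0).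
rewrite -phi_mul_minor; first by ring.
move=> i; rewrite /P; case: (ltnP (I i) 4) => Ii; [left|right] => b; rewrite !mxE.
  case: eqP => // e; move: Ii; rewrite e /= -[X in (_ < X)%N]addn0.
  by rewrite ltn_add2l.
by case: eqP => // e; move: Ii; rewrite e /= leqNgt ltn_ord.
Qed.

Lemma col_mx_entry0 (R : Type) (m n : nat) (u : 'rV[R]_n) (Y : 'M[R]_(m, n)) b :
  (col_mx u Y : 'M_(m.+1, n)) (inord 0) b = u 0 b.
Proof. by rewrite mxE; case: splitP => i; rewrite inordK // ord1. Qed.

Lemma col_mx_entryS (R : Type) (m n : nat) (u : 'rV[R]_n) (Y : 'M[R]_(m.+1, n)) a b :
  (a < m.+1)%N ->
  (col_mx u Y : 'M_(m.+2, n)) (inord a.+1) b = Y (inord a) b.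
Proof.
move=> am; rewrite mxE; case: splitP => i; rewrite inordK //; first by rewrite ord1.
by rewrite add1n => -[e]; congr (Y _ _); apply/ord_inj; rewrite -e inordK.
Qed.

Lemma example_coef_e1234 (R : realType) (t : R) (i j : nat) :
  (i < 4)%N -> example_coef t i (4 + j) = 0.
Proof.
by case: i => [|[|[|[|i]]]] // _; case: j => [|[|[|j]]] //; rewrite /example_coef /= nth_nil.
Qed.

(* [d *phi (e_1, e_2, e_3, e_4, e_7)] is up to sign the trace of the action on
   the span of [e_1, ..., e_4]. *)
Lemma example_not_torsion_free (R : realType) (t : R) : t != 0 -> ~ S_tf (example t).
Proof.
move=> t0 [_ _ tf].
have [k kN0 starE] := star_phi_e1234 R.
(* The rows are e_1, ..., e_4, e_7. *)
pose X : 'M[R]_(5, 7) :=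
  \matrix_(a, l) (l == (if a == 4%N :> nat then 6%N else a) :> nat)%:R.
have mu0 (u v : 'rV[R]_7) : u 0 ord_max = 0 -> v 0 ord_max = 0 -> example t u v = 0.
  by move=> u0 v0; rewrite /example /almost_abelian u0 v0 !scale0r subrr.
have mu6 (u v : 'rV[R]_7) : u 0 ord_max = 0 -> v 0 ord_max = 1 ->
    example t u v = - (u *m example_mx t).
  by move=> u0 v0; rewrite /example /almost_abelian u0 v0 scale0r scale1r sub0r.
(* The first row is [e_i, e_7] on the span of e_1, ..., e_4; below it stand the other three of these
   vectors, [bump] skipping [i]. *)
pose M (i : 'I_4) : 'M[R]_4 := \matrix_(a, b)
  if a == 0%N :> nat then - example_coef t i b else (b == bump i a.-1 :> nat)%:R.
have Xi (i : 'I_4) l : X (lift ord_max i) l = (l == i :> nat)%:R.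
  by rewrite !mxE lift_max (ltn_eqF (ltn_ord i)).
have termE (i : 'I_4) : star_phi (col_mx (example t (row i (row' ord_max X)) (row ord_max X))
     (row' i (row' ord_max X)) : 'M_(1 + 3, 7)) = k * \det (M i).
  have u0 : row i (row' ord_max X) 0 ord_max = 0.
    by rewrite row_row' mxE Xi gtn_eqF //= (leq_trans (ltn_ord i)).
  have v1 : row ord_max X 0 ord_max = 1.
    by rewrite !mxE.
  rewrite (mu6 _ _ u0 v1).
  have -> : row i (row' ord_max X) *m example_mx t = \row_l example_coef t i l.
    have -> : row i (row' ord_max X) = delta_mx 0 (inord i).
      apply/rowP => l; rewrite row_row' mxE Xi mxE eqxx /= -(inj_eq (@ord_inj 7)).
      by rewrite inordK // (leq_trans (ltn_ord i)).
    rewrite -rowE; apply/rowP => l; rewrite !mxE inordK //.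
    by rewrite (leq_trans (ltn_ord i)).
  set Z := (X in star_phi X); rewrite (starE (Z : 'M_(4, 4 + 3))).
    congr (_ * \det _); apply/matrixP => a b; rewrite -(inord_val a) [RHS]mxE.
    case: a => -[|a] a4 /=; rewrite mxE.
      by rewrite (col_mx_entry0 _ _ (lshift 3 b)) inordK // !mxE.
    rewrite (col_mx_entryS _ _ (lshift 3 b)) // inordK //=.
    by rewrite [LHS]mxE [LHS]mxE Xi /= inordK.
  apply/matrixP => a b; rewrite [RHS]mxE -(inord_val a).
  case: a => -[|a] a4 /=; rewrite mxE.
    rewrite (col_mx_entry0 _ _ (rshift 4 b)) !mxE.
    by rewrite example_coef_e1234 ?oppr0.
  rewrite (col_mx_entryS _ _ (rshift 4 b)) // [LHS]mxE [LHS]mxE Xi /=.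
  by rewrite gtn_eqF // (leq_trans (ltn_ord (lift i (inord a)))) ?leq_addr.
(* Only brackets with e_7, the last argument, survive. Expanding the determinants leaves minus the
   trace 4 t, times [k]. *)
have := tf X; rewrite /ce_diff big_ord_recr /= big1; last first.
  move=> j _; apply: big1 => i ij.
  rewrite mu0 ?star_phi_row0 ?mulr0 //.
    by rewrite row_row' !mxE /= /bump leqNgt ij add0n (ltn_eqF (ltn_ord i)) gtn_eqF // (leq_trans (ltn_ord i)).
  by rewrite !mxE /= (ltn_eqF (ltn_ord j)) gtn_eqF // (leq_trans (ltn_ord j)).
rewrite add0r (eq_bigl xpredT) => [|i]; last by rewrite ltn_ord.
under eq_bigr do rewrite termE.
rewrite !big_ord_recl big_ord0 !det4E !mxE !inordK //=.
rewrite /bump /= !(add1n, add0n) /example_coef /= => d0.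
have : - 4 * (k * t) = 0 by rewrite -[RHS]d0; ring.
by apply/eqP; rewrite !mulf_neq0 // oppr_eq0 pnatr_eq0.
Qed.

Lemma example_S_closed (R : realType) (t : R) : @S_closed R (example t).
Proof.
split=> [|X]; last exact: example_closed.
by split; [exact/almost_abelian_lie/example_col | exact/almost_abelian_solvable/example_col].
Qed.

Lemma example_S_real (R : realType) (t : R) : t != 0 -> @S_real R (example t).
Proof.
move=> t0; split; first by case: (example_S_closed t).
(* e_5 lies in the third complex coordinate, where the action is the real scalar - 2 t. *)
apply: (@almost_abelian_real _ _ _ (example_col t) (delta_mx 0 (inord 4)) (- t - t)).
- by apply/eqP => /rowP/(_ (inord 4)); rewrite !mxE !eqxx => /eqP; rewrite oner_eq0.
- by rewrite mxE eqxx -(inj_eq (@ord_inj 7)) inordK.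
- rewrite -rowE; apply/rowP => j; rewrite !mxE inordK // eqxx -(inj_eq (@ord_inj 7)) inordK //=.
  by case: j => -[|[|[|[|[|[|[|j]]]]]]] //= _; rewrite ?mulr0 ?mulr1.
- by rewrite -opprD oppr_eq0 -mulr2n mulrn_eq0.
Qed.

(** 64 t^2 = (16 t^2)^2 / (4 t^2), with |Ric|^2 bounded below by a single squared entry. *)
Lemma example_F_le (R : realType) (t : R) : t != 0 -> F (example t) <= 64 * t ^+ 2.
Proof.
move=> t0; have [[lie _] _] := example_S_closed t.
have Rge : 4 * t ^+ 2 <= Ric_sqnorm (example t).
  rewrite Ric_sqnormE; [|by case: lie..].
  rewrite (bigD1 (inord 0)) //= (bigD1 (inord 3)) //= example_Ric -addrA lerDl.
  rewrite addr_ge0 //; first by apply: sumr_ge0 => j _; apply: sqr_ge0.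
  by apply: sumr_ge0 => i _; apply: sumr_ge0 => j _; apply: sqr_ge0.
have t2 : 0 < t ^+ 2 by rewrite exprn_even_gt0 //= t0.
have R0 : 0 < Ric_sqnorm (example t) by apply: lt_le_trans Rge; lra.
rewrite /F ler_pdivrMr // example_Scal.
have -> : (- 16 * t ^+ 2) ^+ 2 = 64 * t ^+ 2 * (4 * t ^+ 2) by ring.
by apply: ler_wpM2l => //; lra.
Qed.

(** * Positivity and infimum of the numbers n_mu *)

(** Leaving out [S_tf] thus leaves out the zero bracket, where [F] would be 0 / 0 = 0, and makes the
    norm positive in (i). *)
Lemma bracket_sqnorm_eq0 (R : realType) (nu : bracket R 7) :
  S_closed nu -> bracket_sqnorm nu = 0 -> S_tf nu.
Proof.
move=> [[lie sol] cl] /eqP T0; split=> // X.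
have c0 i j k : struct_const nu i j k = 0.
  apply/eqP; rewrite -sqrf_eq0 eq_le sqr_ge0 andbT -(eqP T0).
  exact: struct_const_sqr_le.
have nu0 x y : nu x y = 0.
  rewrite [x]row_sum_delta [y]row_sum_delta.
  rewrite (linear_fun_sum _ _ _ (lie_linear_r lie _)) big1 // => j _.
  rewrite (linear_fun_sum _ _ _ (lie_linear_l lie _)) big1 ?scaler0 // => i _.
  suff -> : nu (delta_mx 0 i) (delta_mx 0 j) = 0 by rewrite scaler0.
  by apply/rowP => k; rewrite [RHS]mxE; exact: c0.
rewrite /ce_diff big1 // => j _; rewrite big1 // => i _.
by rewrite nu0 star_phi_row0 mulr0.
Qed.

Lemma mem_gl_orbit (R : realType) (n : nat) (mu : bracket R n) : gl_orbit mu mu.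
Proof.
exists 1%:M; first exact: unitmx1.
by apply/funext => x; apply/funext => y; rewrite /gl_act invmx1 !mulmx1.
Qed.

Lemma n_inf_gt0 (R : realType) (mu : bracket R 7) :
  (@S_closed R `&` @S_real R) mu -> (0 < n_inf mu)%E.
Proof.
move=> [_ [[lie sol] real]].
have [c c0 bound] := real_type_orbit_bound lie sol real.
apply: (@lt_le_trans _ _ ((c ^+ 2 * (7 * (6 * 7 ^+ 2)) ^+ 2)^-1)%:E).
  by rewrite lte_fin invr_gt0 mulr_gt0 ?exprn_gt0 //; lra.
apply/ereal_infP => _ [nu [[orb clo] ntf] <-]; rewrite lee_fin.
have [[lie' sol'] _] := clo.
apply: F_lower_bound => //; first exact: bound.
rewrite lt0r; apply/andP; split.
  by apply/eqP => T0; apply: ntf; apply: bracket_sqnorm_eq0.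
by do 3![apply: sumr_ge0 => ? _]; apply: sqr_ge0.
Qed.

Unset Implicit Arguments.

Theorem proposition4p1 (R : realType) :
  (forall mu : bracket R 7,
     (@S_closed R `&` @S_real R) mu -> (0 < n_inf mu)%E) /\
  ereal_inf [set n_inf mu | mu in @S_closed R `&` @S_real R] = 0%E.
Proof.
split; first exact: n_inf_gt0.
apply/eqP; rewrite eq_le; apply/andP; split; last first.
  by apply/ereal_infP => _ [mu /n_inf_gt0 mu0 <-]; apply: ltW.
have le t : t != 0 ->
    (ereal_inf [set n_inf mu | mu in @S_closed R `&` @S_real R] <= (64 * t ^+ 2)%:E)%E.
  move=> t0; apply: le_trans (_ : (n_inf (example t) <= _)%E).
    apply: ereal_inf_lbound; exists (example t) => //.
    by split; [exact: example_S_closed | exact: example_S_real].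
  apply: le_trans (_ : ((F (example t))%:E <= _)%E); last first.
    by rewrite lee_fin example_F_le.
  apply: ereal_inf_lbound; exists (example t) => //; split.
    by split; [exact: mem_gl_orbit | exact: example_S_closed].
  exact: example_not_torsion_free.
apply/lee_addgt0Pr => eps eps0; rewrite add0e.
(* t <= 1 gives t^2 <= t, whence 64 t^2 <= 64 t <= eps. *)
pose t := Num.min 1 (eps / 64).
have t0 : 0 < t by rewrite lt_min ltr01 divr_gt0.
apply: le_trans (le t (lt0r_neq0 t0)) _; rewrite lee_fin.
have t1 : t <= 1 by rewrite ge_min lexx.
have te : t <= eps / 64 by rewrite ge_min lexx orbT.
have : t ^+ 2 <= t by rewrite expr2 ler_piMr // ltW.
lra.
Qed.
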